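(* Let $\phi \colon \mathbb{N} \to (0,\infty)$ be a non-decreasing function such that $\phi(n)/\log n \to \gamma$ as $n \to \infty$ for some $\gamma \in [0,\infty]$. Define $$E(\phi) := \left\{ x \in (0,1] : \lim_{n\to\infty} \frac{\log d_n(x)}{\phi(n)} = 1 \right\}.$$ Then $$\dim_H E(\phi) = \max\left\{0, \frac{1-\gamma^{-1}}{1+\xi}\right\}, \quad \text{where} \quad \xi := \limsup_{n\to\infty} \frac{\phi(n+1)}{\sum_{k=1}^n \phi(k)},$$ with the conventions $\infty^{-1}=0$ and $0^{-1}=\infty$. More precisely, $\dim_H E(\phi) = (1+\xi)^{-1}$ if $\gamma = \infty$; $\dim_H E(\phi) = 1-\gamma^{-1}$ if $\gamma \in [1,\infty)$; and $\dim_H E(\phi) = 0$ if $\gamma \in [0,1)$, because in this case $E(\phi) = \varnothing$.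
   Context: Pierce expansion digits: for $x \in (0,1]$ put $d_1(x) := \lfloor 1/x \rfloor$ and $T(x) := 1 - d_1(x)x$, and for $k \in \mathbb{N}$ put $d_k(x) := d_1(T^{k-1}(x))$ provided $T^{k-1}(x) \neq 0$. All digits $d_k(x)$, $k \in \mathbb{N}$, are defined exactly when $x$ is irrational, and then they form a strictly increasing sequence of positive integers. Convention: a limiting condition on $(d_n(x))_n$, or a condition for all (large) $n$, is only considered for irrational $x$, so rational $x$ do not belong to sets defined by such conditions. $\mathbb{N}=\{1,2,\dots\}$, $\log$ is the natural logarithm, $\dim_H$ is the Hausdorff dimension (with $\dim_H \varnothing = 0$), and $c+\infty=\infty$, $c/\infty = 0$ for real $c$. *)

(* Defs.v *)
From mathcomp Require Import all_boot all_order all_algebra.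
From mathcomp Require Import all_classical all_reals all_analysis.

Set Implicit Arguments.
Unset Strict Implicit.
Unset Printing Implicit Defensive.
Import Order.TTheory GRing.Theory Num.Theory.
Import numFieldNormedType.Exports.
Local Open Scope classical_set_scope.
Local Open Scope ring_scope.

Section Hausdorff.
Context {R : realType}.
Local Open Scope ereal_scope.

(* [maxe 0] only serves the empty set, whose supremum would be -oo. *)
Definition diam (A : set R) : \bar R :=
  maxe 0 (ereal_sup [set (`|p.1 - p.2|%R)%:E | p in A `*` A]).

(* Since 0 `^ 0 = 1, the empty set is singled out so that it has weight 0 also
   for s = 0; countable covers thus include the finite ones, and the
   0-dimensional Hausdorff measure is the counting measure. *)
Definition diam_pow (s : R) (A : set R) : \bar R :=
  if A == set0 then 0 else diam A `^ s.

Definition hausdorff_content (s delta : R) (A : set R) : \bar R :=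
  ereal_inf [set \sum_(0 <= k <oo) diam_pow s (U k) |
    U in [set U : (set R)^nat |
      A `<=` \bigcup_k U k /\ forall k, diam (U k) <= delta%:E]].

Definition hausdorff_measure (s : R) (A : set R) : \bar R :=
  ereal_sup [set hausdorff_content s delta A | delta in [set d | (0 < d)%R]].

Definition hausdorff_dim (A : set R) : \bar R :=
  ereal_inf [set s%:E | s in [set s | (0 <= s)%R /\ hausdorff_measure s A = 0]].

End Hausdorff.

Section Pierce.
Context {R : realType}.

Definition pierce_d1 (x : R) : int := Num.floor (1 / x).

Definition pierce_T (x : R) : R := 1 - (pierce_d1 x)%:~R * x.

(* Digits are numbered from 1. The value at k = 0, and the values after
   the iterates of [pierce_T] have reached 0, are junk. *)
Definition pierce_digit (k : nat) (x : R) : int :=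
  pierce_d1 (iter k.-1 pierce_T x).

(* Rational numbers are excluded because they have only finitely many
   digits. *)
Definition pierce_E (phi : nat -> R) : set R :=
  [set x | [/\ x \in `]0, 1], irrational x &
    ln (pierce_digit n x)%:~R / phi n @[n --> \oo] --> (1 : R)]].

End Pierce.

(* Main.v *)
Require Import Defs.
From mathcomp Require Import all_boot all_order all_algebra.
From mathcomp Require Import all_classical all_reals all_analysis.
From mathcomp Require Import ring lra zify.
Set Implicit Arguments.
Unset Strict Implicit.
Unset Printing Implicit Defensive.
Import Order.TTheory GRing.Theory Num.Theory.
Import numFieldNormedType.Exports.
Local Open Scope classical_set_scope.
Local Open Scope ring_scope.

(** Write [d_1 < d_2 < ...] for the digits of [x], [f n = phi (n + 1)] and
    [S n = phi 1 + ... + phi n]. Two points that share their first [n] digits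
    satisfy [|x - y| <= 1 / (d_1 ... d_n d)], where [d] is the smaller of their
    digits of index [n + 1]: the [n]-th iterate of [pierce_T] is affine on the
    common cylinder with slope [d_1 ... d_n] up to sign, and it maps both points
    into [(0, 1 / d)] ([pierce_dist]).
    The dimension of [pierce_E phi] compares the number of admissible strings
    of [n] digits with this quantity.

    Upper bounds. On [pierce_E phi] one has [d_n = exp ((1 + o(1)) phi n)], so
    after a countable decomposition there are at most
    [exp ((1 + e) S n)] strings of length [n], each carried by a set of
    diameter at most [exp (- (1 - e) (S n + f n))], up to constants. Along the
    indices where [f n >= t * S n] this gives measure zero in every dimension
    [s] with [s * (1 + t) > 1] ([pierce_E_null_fast]), hence the bound
    [1 / (1 + xi)]. If [phi n] is asymptotic to [gamma * ln n], the monotonicity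
    of the digits can no longer be ignored: the number of strings is at most a
    binomial coefficient ['C(n ^ gamma, n)], and the gain of [n!] turns the
    bound into [1 - 1 / gamma] ([pierce_E_null_poly]).

    Lower bound. For a nondecreasing [psi] the Cantor set [block_set] of the
    points whose [n]-th digit lies in the block
    [[n * exp (psi n), (n + 1) * exp (psi n))], up to rounding, has digits with
    logarithm within [ln 2] of [ln n + psi n] for large [n], and the blocks
    follow each other in increasing order. For
    [gamma] infinite take [psi = phi]; for [gamma] in [(1, oo)] take
    [psi n = (gamma - 1) * ln n]; in both cases the Cantor set lies in
    [pierce_E phi] ([pierce_E_measure_neq0]). Its points are coded by the digits
    of the Cantor series of [y] in [[0, 1)], and the coding map [g] satisfies a mass
    distribution estimate: the preimage of a set of diameter [r] is contained
    in a set of Lebesgue measure [O(r ^ s)] ([preimage_cover]). As the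
    preimages of a cover exhaust [[0, 1)], subadditivity of Lebesgue measure
    bounds the Hausdorff sums from below ([hausdorff_measure_block_set]). The
    exponent obtained is [1 / (1 + th + xi)] with [th = lim ln n / psi n], which
    is [1 / (1 + xi)] in the first case and [(gamma - 1) / gamma] in the second,
    where [xi = 0]; for [gamma = 1] the claimed value is [0].

    If [gamma < 1] the set is empty since [d_n >= n] forces
    [ln d_n / phi n] to stay above a constant larger than [1]. *)

(** * Covering criteria for Hausdorff measure *)

Section HausdorffTools.
Context {R : realType}.
Implicit Types (A B : set R) (s d e r : R).
Local Open Scope ereal_scope.

Lemma diam_ge0 A : 0 <= diam A.
Proof. by rewrite /diam le_max lexx. Qed.

Lemma dist_le_diam A x y : A x -> A y -> (`|x - y|%R)%:E <= diam A.
Proof.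
move=> Ax Ay; rewrite /diam le_max; apply/orP; right.
by apply: ereal_sup_ubound; exists (x, y).
Qed.

Lemma diam_le A r : (0 <= r)%R -> (forall x y, A x -> A y -> `|x - y| <= r)%R ->
  diam A <= r%:E.
Proof.
move=> r0 Ar; rewrite /diam ge_max lee_fin r0 /=.
by apply: ge_ereal_sup => _ [[x y] [/= Ax Ay] <-]; rewrite lee_fin Ar.
Qed.

Lemma diam_pow_ge0 s A : 0 <= diam_pow s A.
Proof. by rewrite /diam_pow; case: ifP => // _; exact: poweR_ge0. Qed.

Lemma diam_pow0 s : diam_pow s set0 = 0 :> \bar R.
Proof. by rewrite /diam_pow eqxx. Qed.

Lemma diam_pow_le s A r : (0 <= s)%R -> (0 <= r)%R ->
  (forall x y, A x -> A y -> `|x - y| <= r)%R -> diam_pow s A <= (r `^ s)%:E.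
Proof.
move=> s0 r0 Ar; rewrite /diam_pow; case: ifP => _.
  by rewrite lee_fin powR_ge0.
rewrite -poweR_EFin; apply: gt0_ler_poweR => //.
- by rewrite in_itv /= diam_ge0 leey.
- by rewrite in_itv /= lee_fin r0 leey.
- exact: diam_le.
Qed.

Lemma hausdorff_measure_ge0 s A : 0 <= hausdorff_measure s A.
Proof.
apply: le_ereal_sup_tmp; exists (hausdorff_content s 1 A).
  by exists 1%R => //=; exact: ltr01.
apply: le_ereal_inf_tmp => _ [U _ <-].
by apply: nneseries_ge0 => k _ _; exact: diam_pow_ge0.
Qed.

(** For positive exponents small total weight forces small diameters, so the
    scale restriction in the definition of the Hausdorff measure is harmless
    when one wants to show that the measure vanishes. *)
Lemma hausdorff_measure_eq0 s A : (0 < s)%R ->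
  (forall e, (0 < e)%R -> exists U : (set R)^nat,
     A `<=` \bigcup_k U k /\ \sum_(0 <= k <oo) diam_pow s (U k) <= e%:E) ->
  hausdorff_measure s A = 0.
Proof.
move=> s0 H; apply/eqP; rewrite eq_le hausdorff_measure_ge0 andbT.
apply: ge_ereal_sup => _ [d /= d0 <-].
apply/lee_addgt0Pr => e e0; rewrite add0e.
pose e' := (Num.min e (d `^ s))%R.
have e'0 : (0 < e')%R by rewrite lt_min e0 powR_gt0.
have [U [AU Ue]] := H _ e'0.
apply: ge_ereal_inf; exists (\sum_(0 <= k <oo) diam_pow s (U k)); last first.
  by apply: le_trans Ue _; rewrite lee_fin ge_min lexx.
exists U => //; split => // k.
have [U0|U0] := eqVneq (U k) set0.
  rewrite U0; apply: diam_le; first exact: ltW.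
  by move=> x y [].
have : diam_pow s (U k) <= (d `^ s)%:E.
  apply: (@le_trans _ _ (\sum_(0 <= k <oo) diam_pow s (U k))).
    rewrite (@nneseries_split _ _ 0%N k.+1); last by move=> *; exact: diam_pow_ge0.
    rewrite add0n big_nat_recr//= -addeA addeC -addeA leeDl//.
    rewrite adde_ge0 ?sume_ge0// => *; rewrite ?diam_pow_ge0//.
    by apply: nneseries_ge0 => *; exact: diam_pow_ge0.
  by apply: le_trans Ue _; rewrite lee_fin ge_min lexx orbT.
rewrite /diam_pow (negbTE U0) => h; rewrite leNgt; apply/negP => dU.
move: h; apply/negP; rewrite -ltNge -poweR_EFin.
have := diam_ge0 (U k); case: (diam (U k)) dU => [u|_ _|//].
  rewrite !lte_fin lee_fin => du u0.
  by apply: gt0_ltr_powR => //; rewrite nnegrE// ltW.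
by rewrite /= gt_eqF// ltry.
Qed.

Lemma hausdorff_measure_eq0_cover s A d e : (0 < d)%R -> (0 < e)%R ->
  hausdorff_measure s A = 0 ->
  exists U : (set R)^nat, [/\ A `<=` \bigcup_k U k,
     forall k, diam (U k) <= d%:E &
     \sum_(0 <= k <oo) diam_pow s (U k) < e%:E].
Proof.
move=> d0 e0 H.
have : hausdorff_content s d A < e%:E.
  apply: le_lt_trans (_ : 0 < _); last by rewrite lte_fin.
  by rewrite -H; apply: ereal_sup_ubound; exists d.
by move=> /ereal_inf_lt[_ [U [AU Ud] <-]] Ue; exists U.
Qed.

Lemma hausdorff_measure_eq0_sub s A B : A `<=` B ->
  hausdorff_measure s B = 0 -> hausdorff_measure s A = 0.
Proof.
move=> AB B0; apply/eqP; rewrite eq_le hausdorff_measure_ge0 andbT -B0.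
apply: ge_ereal_sup => _ [d d0 <-].
apply: (@le_trans _ _ (hausdorff_content s d B)).
  apply: ereal_inf_le_tmp => _ [U [BU Ud] <-]; exists U => //; split => //.
  exact: subset_trans BU.
by apply: ereal_sup_ubound; exists d.
Qed.

(** Without scale restriction the content is the outer measure generated by the weight
    [diam_pow s] on the discrete sigma-algebra, hence countably subadditive; for
    positive [s] it has the same null sets as the Hausdorff measure. *)
Lemma hausdorff_measure_eq0_bigcup s (A : (set R)^nat) : (0 < s)%R ->
  (forall n, hausdorff_measure s (A n) = 0) ->
  hausdorff_measure s (\bigcup_n A n) = 0.
Proof.
move=> s0 A0.
pose T := g_sigma_algebraType (setT : set (set R)).
pose mu : set T -> \bar R := diam_pow s.
have mT (X : set T) : measurable X by exact: sub_sigma_algebra.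
have muge0 X : 0 <= mu X by exact: diam_pow_ge0.
have extA n : mu_ext mu (A n : set T) = 0.
  apply/eqP; rewrite eq_le mu_ext_ge0// andbT.
  apply/lee_addgt0Pr => e e0; rewrite add0e.
  have [U [AU _ Ue]] := hausdorff_measure_eq0_cover ltr01 e0 (A0 n).
  by apply: ge_ereal_inf; exists (\sum_(0 <= k <oo) diam_pow s (U k));
    [exists U|exact: ltW].
have ext : mu_ext mu (\bigcup_n A n : set T) <= 0.
  apply: le_trans (mu_ext_sigma_subadditive muge0 _) _.
  by rewrite eseries0// => i _ _; rewrite extA.
apply: hausdorff_measure_eq0 => // e e0.
have : mu_ext mu (\bigcup_n A n : set T) < e%:E.
  by apply: le_lt_trans ext _; rewrite lte_fin.
by move=> /ereal_inf_lt[_ [U [_ AU] <-]] Ue; exists U; split => //; exact: ltW.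
Qed.

(** The cover consists of the fibres of a coding map [f] with values in a finite
    set [P]; [P] is kept separate from the type [I] so that constrained strings
    of digits can be counted. *)
Lemma hausdorff_measure_eq0_code s A : (0 < s)%R ->
  (forall e, (0 < e)%R -> exists (I : finType) (P : {pred I}) (f : R -> I) (d : R),
     [/\ (0 <= d)%R, forall x, A x -> f x \in P,
         forall x y, A x -> A y -> f x = f y -> (`|x - y| <= d)%R &
         (#|P|%:R * d `^ s <= e)%R]) ->
  hausdorff_measure s A = 0.
Proof.
move=> s0 H; apply: hausdorff_measure_eq0 => // e /H[I [P [f [d [d0 AP Ad Pe]]]]].
pose U k : set R := if (k < #|P|)%N then
  [set x | A x /\ exists2 i, i \in P & f x = i /\ index i (enum P) = k] else set0.
exists U; split.
  move=> x Ax; exists (index (f x) (enum P)) => //.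
  rewrite /U cardE index_mem mem_enum AP//=; split=> //.
  by exists (f x) => //; exact: AP.
rewrite (@nneseries_split _ _ 0%N #|P|); last by move=> *; exact: diam_pow_ge0.
rewrite add0n [X in _ + X]eseries0 ?adde0; last first.
  by move=> k Pk _; rewrite /U ltnNge Pk /= diam_pow0.
apply: (@le_trans _ _ (\sum_(0 <= k < #|P|) (d `^ s)%:E)).
  apply: lee_sum => k _; apply: diam_pow_le => //; first exact: ltW.
  move=> x y; rewrite /U; case: ifP => // _ [Ax [i iP [fx ik]]] [Ay [j jP [fy jk]]].
  apply: Ad => //; rewrite fx fy.
  by apply: (@index_inj _ i (enum P)); rewrite ?mem_enum ?ik ?jk.
by rewrite sumEFin lee_fin sumr_const_nat subn0 -mulr_natl.
Qed.

Lemma hausdorff_dim_ge0 A : 0 <= hausdorff_dim A.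
Proof. by apply: le_ereal_inf_tmp => _ [s [s0 _] <-]; rewrite lee_fin. Qed.

Lemma hausdorff_dim_le A (b : \bar R) : 0 <= b ->
  (forall s, b < s%:E -> hausdorff_measure s A = 0) -> hausdorff_dim A <= b.
Proof.
case: b => [b|_ _|//]; last exact: leey.
rewrite lee_fin => b0 H; apply/lee_addgt0Pr => e e0.
apply: ereal_inf_lbound; exists (b + e)%R => //; split; first lra.
by apply: H; rewrite lte_fin; lra.
Qed.

Lemma hausdorff_dim_ge A (b : \bar R) :
  (forall s, (0 <= s)%R -> s%:E < b -> hausdorff_measure s A <> 0) ->
  b <= hausdorff_dim A.
Proof.
move=> H; apply: le_ereal_inf_tmp => _ [s [s0 sA] <-].
by rewrite leNgt; apply/negP => /(H s s0).
Qed.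

Lemma hausdorff_dim_set0 : hausdorff_dim (set0 : set R) = 0.
Proof.
apply/eqP; rewrite eq_le hausdorff_dim_ge0 andbT.
apply: hausdorff_dim_le => // s; rewrite lte_fin => s0.
apply: hausdorff_measure_eq0 => // e e0; exists (fun=> set0); split => //.
by rewrite eseries0 ?lee_fin ?ltW// => i _ _; rewrite diam_pow0.
Qed.

End HausdorffTools.

(** * Digits and cylinders of the Pierce expansion *)

Section PierceDigits.
Context {R : realType}.
Implicit Types (x y p h l : R) (n i j : nat) (d : nat -> nat).

Local Notation T := (@pierce_T R).

(** The points all of whose digits are defined. *)
Definition pierce_dom : set R := [set x | 0 < x <= 1 /\ irrational x].

(** Digits are numbered from 0 here: [dig n] is [pierce_digit n.+1]. *)
Definition dig n x : nat := `|pierce_digit n.+1 x|%N.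

Lemma intr_natS (k : nat) : (k%:Z + 1)%:~R = k.+1%:R :> R.
Proof. by rewrite intrD -natr1. Qed.

Lemma pierce_d1_eq x (k : nat) : (0 < k)%N -> k.+1%:R^-1 < x <= k%:R^-1 ->
  pierce_d1 x = k%:Z.
Proof.
move=> k0 /andP[h1 h2]; have x0 : 0 < x by apply: lt_trans h1; rewrite invr_gt0.
rewrite /pierce_d1; apply: Num.Theory.floor_def; rewrite div1r.
have kR : (0 : R) < k%:R by rewrite ltr0n.
rewrite -(invrK (k%:Z%:~R)) lef_pV2 ?posrE ?invr_gt0//= h2 /=.
by rewrite intr_natS -(invrK (k.+1%:R)) ltf_pV2 ?posrE ?invr_gt0.
Qed.

Lemma pierce_TE x (k : nat) : (0 < k)%N -> k.+1%:R^-1 < x <= k%:R^-1 ->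
  T x = 1 - k%:R * x.
Proof. by move=> k0 h; rewrite /pierce_T (pierce_d1_eq k0 h). Qed.

Lemma irrational_affine x (a : int) : a != 0 ->
  irrational x -> irrational (1 - a%:~R * x).
Proof.
move=> a0 xi [q _ qx]; apply: xi; exists ((1 - q) / a%:Q) => //.
have aR : a%:~R != 0 :> R by rewrite intr_eq0.
by rewrite fmorph_div /= rmorphB /= rmorph1 ratr_int qx; field.
Qed.

Lemma pierce_dom_d1 x : pierce_dom x -> exists2 k : nat, (0 < k)%N &
  pierce_d1 x = k%:Z /\ k.+1%:R^-1 < x < k%:R^-1.
Proof.
move=> [/andP[x0 x1] xi].
have := floor_itv (1 / x); rewrite -/(pierce_d1 x).
have : 0 < pierce_d1 x by rewrite /pierce_d1 floor_gt0 ler_pdivlMr ?mul1r.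
case: (pierce_d1 x) => // k; rewrite ltz_nat => k0.
have kR : (0 : R) < k%:R by rewrite ltr0n.
rewrite intr_natS div1r => /andP[h1 h2].
exists k => //; split => //; apply/andP; split.
  by rewrite -[x]invrK ltf_pV2 ?posrE ?invr_gt0.
rewrite lt_neqAle; apply/andP; split.
  apply/eqP => xk; apply: xi; exists (k%:Q^-1) => //.
  by rewrite fmorphV /= ratr_int xk.
by rewrite -[x]invrK lef_pV2 ?posrE ?invr_gt0.
Qed.

Lemma pierce_dom_T x : pierce_dom x -> pierce_dom (T x).
Proof.
move=> xd; have [k k0 [kx /andP[h1 h2]]] := pierce_dom_d1 xd.
have kR : (0 : R) < k%:R by rewrite ltr0n.
have x0 : 0 < x by apply: lt_trans h1; rewrite invr_gt0.
rewrite /pierce_T kx; split.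
  apply/andP; split; last by have : 0 < k%:R * x by [rewrite mulr_gt0]; lra.
  by rewrite subr_gt0 -ltr_pdivlMl// mulr1.
by apply: irrational_affine xd.2; rewrite eqz_nat -lt0n.
Qed.

Lemma pierce_dom_iter n x : pierce_dom x -> pierce_dom (iter n T x).
Proof. by move=> xd; elim: n => [//|n IH]; rewrite iterS; exact: pierce_dom_T. Qed.

Lemma pierce_digitE n x : pierce_dom x -> pierce_digit n.+1 x = (dig n x)%:Z.
Proof.
move=> /(pierce_dom_iter n)/pierce_dom_d1[k _ [kx _]].
by rewrite /dig /pierce_digit /= kx.
Qed.

Lemma dig_itv n x : pierce_dom x ->
  (dig n x).+1%:R^-1 < iter n T x < (dig n x)%:R^-1.
Proof.
move=> /(pierce_dom_iter n)/pierce_dom_d1[k _ [kx h]].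
by rewrite /dig /pierce_digit /= kx.
Qed.

Lemma dig_gt0 n x : pierce_dom x -> (0 < dig n x)%N.
Proof.
move=> /(pierce_dom_iter n)/pierce_dom_d1[k k0 [kx h]].
by rewrite /dig /pierce_digit /= kx.
Qed.

Lemma iter_pierce_T n x : pierce_dom x ->
  iter n.+1 T x = 1 - (dig n x)%:R * iter n T x.
Proof.
move=> /(pierce_digitE n) E.
by rewrite iterS {1}/pierce_T -[pierce_d1 _]/(pierce_digit n.+1 x) E.
Qed.

Lemma dig_ltS n x : pierce_dom x -> (dig n x < dig n.+1 x)%N.
Proof.
move=> xd; have /andP[h1 h2] := dig_itv n xd.
have /andP[g1 _] := dig_itv n.+1 xd.
have k0 : (0 : R) < (dig n x)%:R by rewrite ltr0n dig_gt0.
have : iter n.+1 T x < (dig n x).+1%:R^-1.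
  rewrite iter_pierce_T// ltrBlDr -ltrBlDl.
  apply: le_lt_trans (_ : (dig n x)%:R * (dig n x).+1%:R^-1 < _).
    rewrite -natr1; have : (dig n x)%:R + 1 != 0 :> R by rewrite natr1.
    by move=> ?; rewrite le_eqVlt; apply/orP; left; apply/eqP; field.
  by rewrite ltr_pM2l.
move=> /(lt_trans g1); rewrite ltf_pV2 ?posrE ?ltr0n// ltr_nat; lia.
Qed.

Lemma dig_lt n m x : pierce_dom x -> (n < m)%N -> (dig n x < dig m x)%N.
Proof.
move=> xd; elim: m => // m IH; rewrite ltnS leq_eqVlt => /orP[/eqP->|/IH].
  exact: dig_ltS.
by move=> /ltn_trans; apply; exact: dig_ltS.
Qed.

Lemma dig_gtn n x : pierce_dom x -> (n < dig n x)%N.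
Proof.
move=> xd; elim: n => [|n IH]; first exact: dig_gt0.
exact: leq_ltn_trans IH (dig_ltS _ xd).
Qed.

(** On a cylinder the iterates of [pierce_T] are affine, with slope the signed
    product of the digits. *)
Lemma pierce_sub n x y : pierce_dom x -> pierce_dom y ->
  (forall i, (i < n)%N -> dig i x = dig i y) ->
  iter n T x - iter n T y = (-1) ^+ n * (\prod_(i < n) (dig i x)%:R) * (x - y).
Proof.
move=> xd yd; elim: n => [|n IH] H; first by rewrite big_ord0 expr0 !mul1r.
rewrite !iter_pierce_T// -H// big_ord_recr/= exprS.
have -> : 1 - (dig n x)%:R * iter n T x - (1 - (dig n x)%:R * iter n T y) =
  - (dig n x)%:R * (iter n T x - iter n T y) by ring.
by rewrite IH; [ring|move=> i ni; apply: H; exact: ltnW].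
Qed.

Lemma pierce_dist n x y : pierce_dom x -> pierce_dom y ->
  (forall i, (i < n)%N -> dig i x = dig i y) ->
  `|x - y| * \prod_(i < n) (dig i x)%:R <=
    Num.max (dig n x)%:R^-1 (dig n y)%:R^-1.
Proof.
move=> xd yd H.
have -> : `|x - y| * \prod_(i < n) (dig i x)%:R = `|iter n T x - iter n T y|.
  rewrite (pierce_sub xd yd H) !normrM normrX normrN1 expr1n mul1r mulrC.
  by rewrite ger0_norm// prodr_ge0.
have /andP[x1 x2] := dig_itv n xd; have /andP[y1 y2] := dig_itv n yd.
have x0 : 0 < iter n T x by apply: lt_trans x1; rewrite invr_gt0.
have y0 : 0 < iter n T y by apply: lt_trans y1; rewrite invr_gt0.
rewrite le_max !ler_norml; case: (ltP (iter n T x) (iter n T y)) => xy.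
  by apply/orP; right; apply/andP; split; lra.
by apply/orP; left; apply/andP; split; lra.
Qed.

(** [same_cyl n x p] : [p] lies in the interior of the cylinder of order [n.+1]
    of [x]; unlike [x], the point [p] may be rational. *)
Definition same_cyl n x p : Prop := forall i, (i <= n)%N ->
  (dig i x).+1%:R^-1 < iter i T p < (dig i x)%:R^-1.

Lemma same_cyl_dig n x y p i : pierce_dom x -> pierce_dom y ->
  same_cyl n x p -> same_cyl n y p -> (i <= n)%N -> dig i x = dig i y.
Proof.
move=> xd yd Hx Hy ni.
have /andP[x1 x2] := Hx _ ni; have /andP[y1 y2] := Hy _ ni.
have E1 : pierce_d1 (iter i T p) = (dig i x)%:Z.
  by apply: pierce_d1_eq; rewrite ?dig_gt0// x1 ltW.
have E2 : pierce_d1 (iter i T p) = (dig i y)%:Z.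
  by apply: pierce_d1_eq; rewrite ?dig_gt0// y1 ltW.
by move: E2; rewrite E1 => -[].
Qed.

Lemma dig_shift n x : dig n.+1 x = dig n (T x).
Proof. by rewrite /dig /pierce_digit /= -iterSr. Qed.

(** A cylinder is an interval, so each of its points sees at least half of it on
    one side. Pulling this back along the inverse branches of [pierce_T] divides
    lengths by the digits and exchanges the sides; the factor 4 (rather than 2)
    keeps the neighbourhood away from the endpoints. *)
Lemma same_cyl_side n x : pierce_dom x -> exists b : bool, forall h,
  0 <= h -> h * (4 * ((dig n x).+1%:R ^+ 2 * \prod_(i < n) (dig i x)%:R)) <= 1 ->
  same_cyl n x (x + (-1) ^+ b * h).
Proof.
elim: n x => [|n IH] x xd.
  have /andP[] := dig_itv 0 xd; rewrite /= => h1 h2.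
  have k0 : (0 : R) < (dig 0 x)%:R by rewrite ltr0n dig_gt0.
  have k1 : (0 : R) < (dig 0 x).+1%:R by [].
  pose len : R := (dig 0 x)%:R^-1 - (dig 0 x).+1%:R^-1.
  have lenP h : 0 <= h -> h * (4 * ((dig 0 x).+1%:R ^+ 2 * \prod_(i < 0) (dig i x)%:R)) <= 1 ->
      h < len / 2.
    move=> hge; rewrite big_ord0 mulr1 => hl.
    have -> : len = ((dig 0 x)%:R * (dig 0 x).+1%:R)^-1.
      rewrite /len -natr1; have : (dig 0 x)%:R + 1 != 0 :> R by rewrite natr1.
      by move=> n1; field; rewrite n1 gt_eqF.
    rewrite ltr_pdivlMr// -[X in _ < X]mul1r ltr_pdivlMr ?mulr_gt0//.
    move: hl; rewrite -natr1; set D : R := _%:R in k0 * => hl.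
    have : 0 <= h * D by rewrite mulr_ge0// ltW.
    by rewrite expr2 in hl; nra.
  case: (ltP x ((dig 0 x).+1%:R^-1 + len / 2)) => xm.
    exists false => h hge /(lenP _ hge) hl i; rewrite leqn0 => /eqP -> /=.
    rewrite expr0 mul1r; move: hl xm h1 h2; rewrite /len.
    move: (_.+1%:R^-1) (_%:R^-1) => v u *; apply/andP; split; lra.
  exists true => h hge /(lenP _ hge) hl i; rewrite leqn0 => /eqP -> /=.
  rewrite expr1 mulN1r; move: hl xm h1 h2; rewrite /len.
  move: (_.+1%:R^-1) (_%:R^-1) => v u *; apply/andP; split; lra.
have [b Hb] := IH _ (pierce_dom_T xd).
exists (~~ b) => h hge hl i ni.
have k0 : (0 : R) < (dig 0 x)%:R by rewrite ltr0n dig_gt0.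
have Tx := iter_pierce_T 0 xd; rewrite /= in Tx.
have /Hb Hc : 0 <= (dig 0 x)%:R * h by rewrite mulr_ge0// ltW.
have {}Hc : same_cyl n (T x) (T x + (-1) ^+ b * ((dig 0 x)%:R * h)).
  apply: Hc; apply: le_trans hl; rewrite big_ord_recl /= dig_shift.
  under [in X in _ <= X]eq_bigr do rewrite dig_shift.
  rewrite le_eqVlt; apply/orP; left; apply/eqP; ring.
have cylx : (dig 0 x).+1%:R^-1 < x + (-1) ^+ (~~ b) * h < (dig 0 x)%:R^-1.
  have /andP[q0 q1] := Hc 0%N isT; rewrite /= in q0 q1.
  have q2 : T x + (-1) ^+ b * ((dig 0 x)%:R * h) < (dig 0 x).+1%:R^-1.
    apply: lt_le_trans q1 _; rewrite lef_pV2 ?posrE ?ltr0n ?dig_gt0 ?ler_nat//.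
      by rewrite -dig_shift dig_ltS.
    exact: pierce_dom_T.
  have q3 : 0 < T x + (-1) ^+ b * ((dig 0 x)%:R * h) by apply: lt_trans q0; rewrite invr_gt0.
  have E : T x + (-1) ^+ b * ((dig 0 x)%:R * h) =
      1 - (dig 0 x)%:R * (x + (-1) ^+ (~~ b) * h).
    by rewrite Tx; case: b {Hb Hc q0 q1 q2 q3} => /=; rewrite ?expr1 ?expr0; ring.
  rewrite E in q2 q3; apply/andP; split; last first.
    by rewrite -[X in _ < X]mulr1 ltr_pdivlMl//; lra.
  have k1 : (0 : R) < (dig 0 x).+1%:R by [].
  have : (dig 0 x).+1%:R^-1 * ((dig 0 x)%:R + 1) = 1 :> R.
    by rewrite natr1 mulVf// gt_eqF.
  by rewrite -(ltr_pM2l k0); move: q2; move: (_.+1%:R^-1) => v *; lra.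
case: i ni => [//|i]; rewrite ltnS => ni.
rewrite dig_shift iterSr (@pierce_TE (x + _) _ (dig_gt0 0 xd)); last first.
  by case/andP: cylx => q0 q1; rewrite q0 ltW.
have -> : 1 - (dig 0 x)%:R * (x + (-1) ^+ (~~ b) * h) =
    T x + (-1) ^+ b * ((dig 0 x)%:R * h).
  by rewrite Tx; case: b {Hb Hc cylx} => /=; rewrite ?expr1 ?expr0; ring.
exact: Hc.
Qed.

(** A point with infinitely many nonzero iterates cannot be rational: with a
    common denominator the numerators would decrease forever. *)
Lemma irrational_descent (d : nat -> nat) (z : nat -> R) :
  (forall n, 0 < z n) -> (forall n, z n.+1 < z n) ->
  (forall n, z n.+1 = 1 - (d n)%:R * z n) -> irrational (z 0%N).
Proof.
move=> z0 zlt zS /rationalP[a [b ab]].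
have b0 : (0 < b)%N.
  by case: b ab => // ab; move: (z0 0%N); rewrite ab invr0 mulr0 ltxx.
have bR : (0 : R) < b%:R by rewrite ltr0n.
have zint n : exists c : int, b%:R * z n = c%:~R.
  elim: n => [|n [c IH]]; first by exists a; rewrite ab mulrC divfK// gt_eqF.
  exists (b%:Z - (d n)%:Z * c); rewrite zS mulrBr mulr1 mulrCA IH.
  by rewrite intrB intrM.
have [c0 c0E] := zint 0%N.
have zn n : b%:R * z n + n%:R <= c0%:~R.
  elim: n => [|n IH]; first by rewrite addr0 c0E.
  apply: le_trans IH; have [c cE] := zint n; have [c' c'E] := zint n.+1.
  rewrite cE c'E -!(intrD _ _ (Posz _)) ler_int.
  have : (c'%:~R : R) < c%:~R by rewrite -cE -c'E ltr_pM2l.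
  rewrite ltr_int; lia.
have := zn `|c0|%N; have := z0 `|c0|%N; rewrite -(pmulr_rgt0 _ bR) => h1 h2.
have : (c0%:~R : R) <= (`|c0|%N)%:R by rewrite -[X in _ <= X]/((`|c0|%N)%:Z%:~R) ler_int; lia.
lra.
Qed.

(** The tails [X n] of the expansion solve [X n = (1 - X n.+1) / d n]. Unfolding
    this equation [j] times gives the approximations [S j n], which converge
    geometrically because [d n >= 2] for positive [n]; the value at [n = 0], where
    [d 0 = 1] is possible, is then defined by the equation itself. *)
Lemma pierce_realization d : (0 < d 0)%N -> (forall n, d n < d n.+1)%N ->
  exists2 x, pierce_dom x & forall n, dig n x = d n.
Proof.
move=> d0 dlt.
have dpos n : (n < d n)%N.
  by elim: n => // n IH; exact: leq_ltn_trans IH (dlt n).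
have dR n : (0 : R) < (d n)%:R by rewrite ltr0n (leq_ltn_trans _ (dpos n)).
pose fix S (j n : nat) {struct j} : R := if j is j'.+1 then (1 - S j' n.+1) / (d n)%:R else 0.
have SE j n : S j.+1 n = (1 - S j n.+1) / (d n)%:R by [].
have dlt1 n : (d n.+1)%:R^-1 <= ((d n).+1%:R)^-1 :> R.
  by rewrite lef_pV2 ?posrE// ler_nat.
have d1 n : (d n.+1)%:R^-1 <= 2^-1 :> R.
  by rewrite lef_pV2 ?posrE// ler_nat; apply: leq_trans (dpos n.+1).
have S01 j n : 0 <= S j n <= (d n)%:R^-1.
  elim: j n => [|j IH] n; first by rewrite lexx invr_ge0 ltW.
  rewrite SE; have /andP[h1 h2] := IH n.+1; have := d1 n => h3.
  rewrite divr_ge0 ?(ltW (dR n))//=; last lra.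
  by rewrite ler_pdivrMr// mulVf ?gt_eqF//; lra.
have Sdist j n : `|S j.+1 n.+1 - S j n.+1| <= (1 / 2) ^+ j.
  elim: j n => [|j IH] n.
    have /andP[h1 h2] := S01 1%N n.+1; rewrite subr0 expr0 ger0_norm//.
    by have := d1 n; lra.
  have -> : S j.+2 n.+1 - S j.+1 n.+1 = - (S j.+1 n.+2 - S j n.+2) * (d n.+1)%:R^-1.
    by rewrite !SE; ring.
  rewrite normrM normrN exprSr; apply: ler_pM => //.
  by rewrite ger0_norm ?invr_ge0// div1r; exact: d1.
have Scvg n : cvgn (S ^~ n.+1).
  rewrite -[X in cvgn X](_ : series (telescope (S ^~ n.+1)) = _); last first.
    by rewrite telescopeK; apply/funext => j /=; rewrite subr0.
  apply: normed_cvg; apply: (@series_le_cvg _ _ (geometric 1 (1 / 2))) => //=.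
  - by move=> j; rewrite [X in _ <= X]mul1r; exact: Sdist.
  - by apply: is_cvg_geometric_series; rewrite ger0_norm//; lra.
pose X n : R := if n is n'.+1 then limn (S ^~ n'.+1)
  else (1 - limn (S ^~ 1%N)) / (d 0)%:R.
have X01 n : 0 <= X n.+1 <= (d n.+1)%:R^-1.
  apply/andP; split.
    by apply: limr_ge => //; apply: nearW => j; case/andP: (S01 j n.+1).
  by apply: limr_le => //; apply: nearW => j; case/andP: (S01 j n.+1).
have XS n : X n = (1 - X n.+1) / (d n)%:R.
  case: n => [//|n]; apply: cvg_lim => //.
  rewrite -(cvg_shiftS (S ^~ n.+1)) /=.
  apply: cvgMl; apply: cvgB; [exact: cvg_cst|exact: Scvg].
have Xpos n : 0 < X n.
  rewrite XS divr_gt0//; have := X01 n; have := d1 n; lra.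
have Xltd n : X n < (d n)%:R^-1.
  by rewrite XS ltr_pdivrMr// mulVf ?gt_eqF//; have := Xpos n.+1; lra.
have Xgtd n : (d n).+1%:R^-1 < X n.
  have h : X n.+1 < (d n).+1%:R^-1 by exact: lt_le_trans (Xltd _) (dlt1 _).
  rewrite XS ltr_pdivlMr//; apply: (@le_lt_trans _ _ (1 - (d n).+1%:R^-1)); last first.
    by move: h; move: (_.+1%:R^-1) => v *; lra.
  have k1 : (d n).+1%:R^-1 * ((d n)%:R + 1) = 1 :> R by rewrite natr1 mulVf.
  by move: k1; move: (_.+1%:R^-1) => v *; lra.
have XT n : X n.+1 = 1 - (d n)%:R * X n.
  by rewrite (XS n) [_%:R * _]mulrC divfK ?gt_eqF//; lra.
have Xlt n : X n.+1 < X n.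
  exact: lt_trans (lt_le_trans (Xltd _) (dlt1 _)) (Xgtd _).
have dn0 n : (0 < d n)%N by exact: leq_ltn_trans (dpos n).
have Xiter n : iter n T (X 0%N) = X n.
  elim: n => [//|n IH]; rewrite iterS IH (pierce_TE (dn0 n)) -?XT//.
  by rewrite Xgtd ltW.
exists (X 0%N).
  split; last exact: (irrational_descent Xpos Xlt XT).
  apply/andP; split; first exact: Xpos. apply: le_trans (ltW (Xltd _)) _.
  by rewrite invf_le1// ler1n.
by move=> n; rewrite /dig /pierce_digit /= Xiter (@pierce_d1_eq _ (d n))// Xgtd ltW.
Qed.

End PierceDigits.

(** * Cantor sets of points with digits in prescribed blocks *)

Section CantorSeries.
Context {R : realType}.
Variable m : nat -> nat.
Implicit Types (x y : R) (n i j : nat).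

(** The Cantor series with bases [m] writes [y] in [[0, 1)] as the sum of the
    [cantor_dig n y / (m 0 ... m n)]; [cantor_rem n y] is the rescaled remainder
    after [n] digits. *)
Fixpoint cantor_rem n y : R :=
  if n is n'.+1 then (m n')%:R * cantor_rem n' y -
    (Num.truncn ((m n')%:R * cantor_rem n' y))%:R else y.

Definition cantor_dig n y : nat := Num.truncn ((m n)%:R * cantor_rem n y).

Lemma cantor_rem_itv n y : (forall n, 0 < m n)%N -> 0 <= y < 1 ->
  0 <= cantor_rem n y < 1.
Proof.
move=> m0 y01; elim: n => [//|n /andP[h1 h2]] /=.
have /truncn_itv/andP[] : 0 <= (m n)%:R * cantor_rem n y by rewrite mulr_ge0.
by rewrite -natr1 => *; apply/andP; split; lra.
Qed.

Lemma cantor_dig_lt n y : (forall n, 0 < m n)%N -> 0 <= y < 1 ->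
  (cantor_dig n y < m n)%N.
Proof.
move=> m0 /(cantor_rem_itv n m0)/andP[h1 h2].
rewrite truncn_lt_nat ?mulr_ge0// -[X in _ < X]mulr1 ltr_pM2l//.
by rewrite ltr0n.
Qed.

Lemma cantor_sub n y z : (forall i, (i < n)%N -> cantor_dig i y = cantor_dig i z) ->
  cantor_rem n y - cantor_rem n z = (\prod_(i < n) m i)%:R * (y - z).
Proof.
elim: n => [|n IH] H; first by rewrite big_ord0 mul1r.
rewrite /= -!/(cantor_dig _ _) H// big_ord_recr natrM /=.
rewrite -[X in _ = X]mulrA [_%:R * (y - z)]mulrC mulrA -IH; last first.
  by move=> i ni; apply: H; exact: ltnW.
by ring.
Qed.

Lemma cantor_dist n y z : (forall n, 0 < m n)%N -> 0 <= y < 1 -> 0 <= z < 1 ->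
  (forall i, (i < n)%N -> cantor_dig i y = cantor_dig i z) ->
  `|y - z| <= (\prod_(i < n) m i)%:R^-1.
Proof.
move=> m0 y01 z01 /cantor_sub E.
have M0 : (0 : R) < (\prod_(i < n) m i)%:R by rewrite ltr0n prodn_gt0.
rewrite -(ler_pM2l M0) mulfV ?gt_eqF// -[X in X * _]gtr0_norm// -normrM -E.
have /andP[a1 a2] := cantor_rem_itv n m0 y01.
have /andP[b1 b2] := cantor_rem_itv n m0 z01.
by rewrite ler_norml; apply/andP; split; lra.
Qed.

End CantorSeries.

Lemma absz_sub_lt (k k0 : int) (t : nat) :
  k0 <= k -> k - k0 - 1 < t.+1%:Z -> (`|k - k0| < t.+2)%N.
Proof. lia. Qed.

Lemma absz_subK (k k0 : int) (i : nat) :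
  k0 <= k -> k0 + (`|k - k0| + i)%N%:Z = k + i%:Z.
Proof. lia. Qed.

Section LowerBound.
Context {R : realType}.
Variable m : nat -> nat.
Hypothesis m_ge2 : forall n, (2 <= m n)%N.
Hypothesis m_nd : forall n, (m n <= m n.+1)%N.
Implicit Types (x y : R) (n i j : nat).

Let m_gt0 n : (0 < m n)%N. Proof. exact: ltnW (m_ge2 n). Qed.

(** Since [m] is nondecreasing, the block of index [n] ends before the block of
    index [n.+1] begins, so that every choice of one integer per block is a
    strictly increasing sequence, hence a sequence of digits. *)
Definition block_set : set R :=
  [set x | pierce_dom x /\ forall n, (n.+1 * m n <= dig n x < n.+2 * m n)%N].

Lemma block_map : exists g : R -> R, forall y, 0 <= y < 1 ->
  pierce_dom (g y) /\ forall n, dig n (g y) = (n.+1 * m n + cantor_dig m n y)%N.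
Proof.
suff /choice[g gP] : forall y : R, exists x, 0 <= y < 1 ->
    pierce_dom x /\ forall n, dig n x = (n.+1 * m n + cantor_dig m n y)%N.
  by exists g.
move=> y; have [y01|] := boolP (0 <= y < 1); last by exists 0.
have c_lt n := cantor_dig_lt n m_gt0 y01.
have [||x xd xn] := @pierce_realization R
  (fun n => (n.+1 * m n + cantor_dig m n y)%N).
- by have := m_gt0 0; lia.
- by move=> n; have := c_lt n; have := m_nd n; nia.
by exists x.
Qed.

(** The number of cylinders of order [n] that meet [block_set]. *)
Definition ncyl n : nat := \prod_(i < n) m i.
(** An upper bound for the product of the first [n] digits on [block_set]. *)
Definition block_den n : nat := \prod_(i < n) (i.+2 * m i).
(** Every point of [block_set] has a one-sided neighbourhood of this length inside
    its cylinder of order [n.+1], by [same_cyl_side]. *)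
Definition cyl_len n : R :=
  (4 * ((n.+2 * m n)%:R ^+ 2 * (block_den n)%:R))^-1.

Lemma ncyl_gt0 n : (0 < ncyl n)%N.
Proof. exact: prodn_gt0. Qed.

Lemma ncyl_ge n : (n < ncyl n)%N.
Proof.
elim: n => [|n IH]; first by rewrite /ncyl big_ord0.
rewrite /ncyl big_ord_recr/= -/(ncyl n).
by have := m_ge2 n; nia.
Qed.

Lemma block_den_gt0 n : (0 < block_den n)%N.
Proof. by apply: prodn_gt0 => i; rewrite muln_gt0 /=. Qed.

Lemma cyl_len_gt0 n : 0 < cyl_len n.
Proof.
by rewrite invr_gt0 !mulr_gt0// ?exprn_gt0 ?ltr0n ?muln_gt0 ?block_den_gt0 ?m_gt0.
Qed.

Lemma cyl_len_le n : cyl_len n <= n.+1%:R^-1.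
Proof.
rewrite lef_pV2 ?posrE//; last by rewrite -invr_gt0; exact: cyl_len_gt0.
rewrite -natrX -natrM -(natrM _ 4) ler_nat.
have := block_den_gt0 n; have := m_gt0 n; set M := m n; set D := block_den n.
rewrite expnS expn1 => ? ?; nia.
Qed.

Lemma block_side n x : block_set x -> exists b : bool, forall h,
  0 <= h <= cyl_len n -> same_cyl n x (x + (-1) ^+ b * h).
Proof.
move=> [xd xb]; have [b Hb] := same_cyl_side n xd.
exists b => h /andP[h0 hl]; apply: Hb => //.
have c0 := cyl_len_gt0 n.
apply: (@le_trans _ _ (h * (cyl_len n)^-1)); last first.
  by rewrite ler_pdivrMr// mul1r.
rewrite ler_wpM2l// invrK ler_pM2l// ler_pM ?exprn_ge0 ?prodr_ge0//.
  by rewrite ler_pXn2r ?nnegrE// ler_nat; have /andP[] := xb n.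
rewrite /block_den natr_prod; apply: ler_prod => i _.
by rewrite ler0n ler_nat ltnW//; have /andP[] := xb i.
Qed.

Local Notation mu := (@lebesgue_measure R).

Variable g : R -> R.
Hypothesis gP : forall y, 0 <= y < 1 ->
  pierce_dom (g y) /\ forall n, dig n (g y) = (n.+1 * m n + cantor_dig m n y)%N.

Lemma block_mapP y : 0 <= y < 1 -> block_set (g y).
Proof.
move=> y01; have [gd gn] := gP y01; split => // n.
rewrite gn; have := cantor_dig_lt n m_gt0 y01; nia.
Qed.

Lemma block_map_dist n y z : 0 <= y < 1 -> 0 <= z < 1 ->
  (forall i, (i < n)%N -> dig i (g y) = dig i (g z)) ->
  `|y - z| <= (ncyl n)%:R^-1.
Proof.
move=> y01 z01 H; apply: cantor_dist => // i ni.
have := H _ ni; have [_ ->] := gP y01; have [_ ->] := gP z01; exact: addnI.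
Qed.

(** Preimage of a ball: the multiples of [cyl_len n] form a grid such that every
    point of the block set shares its cylinder of order [n.+1] with one of the
    two neighbouring grid points, and all points attached to one grid point have
    preimages within distance [(ncyl n.+1)^-1]. *)
Lemma preimage_ball n (x0 r : R) : 0 <= r -> exists V : set R,
  [/\ measurable V, forall y, 0 <= y < 1 -> `|g y - x0| <= r -> V y &
  (mu V <= ((2 * r / cyl_len n + 4) * (2 / (ncyl n.+1)%:R))%:E)%E].
Proof.
move=> r0; pose l := cyl_len n; have l0 : 0 < l := cyl_len_gt0 n.
pose k0 := Num.floor ((x0 - r) / l).
pose p i : R := (k0 + i%:Z)%:~R * l.
pose N := (Num.truncn (2 * r / l) + 4)%N.
pose w : R := (ncyl n.+1)%:R^-1.
have w0 : 0 < w by rewrite invr_gt0 ltr0n ncyl_gt0.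
pose Q i (z : R) := 0 <= z < 1 /\ same_cyl n (g z) (p i).
have /choice[c cP] : forall i, exists z : R, (exists z' : R, Q i z') -> Q i z.
  move=> i; have [[z Qz]|no] := pselect (exists z', Q i z'); first by exists z.
  by exists 0 => /no.
pose W i : set R := [set` `[c i - w, c i + w]].
have mW i : measurable (W i) by exact: measurable_itv.
have muW i : (mu (W i) <= (2 * w)%:E)%E.
  have E := lebesgue_measure_itv `[c i - w, c i + w].
  rewrite [X in (X <= _)%E]E /= lte_fin.
  by case: ifP => _; rewrite ?lee_fin -?EFinB ?lee_fin; lra.
exists (\big[setU/set0]_(i < N) W i); split.
- exact: bigsetU_measurable.
- move=> y y01 yr; have [gd _] := gP y01; set x := g y in yr gd.
  suff [i iN xi] : exists2 i, (i < N)%N & same_cyl n x (p i).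
    rewrite -bigcup_mkord; exists i => //=.
    have [c01 cc] : Q i (c i) by apply: cP; exists y.
    have : `|y - c i| <= w.
      apply: block_map_dist => // j; rewrite ltnS => jn.
      by apply: same_cyl_dig xi cc jn => //; case: (gP c01).
    by rewrite ler_norml /W /= in_itv /= => /andP[*]; apply/andP; split; lra.
  have [b Hb] := block_side n (block_mapP y01); rewrite -/x -/l in Hb.
  have /andP[f1 f2] := floor_itv (x / l); set k := Num.floor (x / l) in f1 f2.
  have /andP[e1 e2] := floor_itv ((x0 - r) / l); rewrite -/k0 in e1 e2.
  rewrite ler_pdivlMr// in f1; rewrite ltr_pdivrMr// intrD in f2.
  rewrite ler_pdivlMr// in e1; rewrite ltr_pdivrMr// intrD in e2.
  have /andP[y1 y2] : - r <= x - x0 <= r by rewrite -ler_norml.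
  have kk0 : k0 <= k.
    by rewrite /k floor_ge_int ler_pdivlMr//; lra.
  have Nlt : (`|k - k0| < (Num.truncn (2 * r / l)).+2)%N.
    have /andP[_] : (Num.truncn (2 * r / l))%:R <= 2 * r / l < (Num.truncn (2 * r / l)).+1%:R.
      by apply: truncn_itv; rewrite divr_ge0 ?mulr_ge0// ltW.
    rewrite ltr_pdivrMr// => tlt.
    have : (k - k0 - 1)%:~R * l < (Num.truncn (2 * r / l)).+1%:Z%:~R * l.
      by rewrite !intrB; lra.
    by rewrite ltr_pM2r// ltr_int; exact: absz_sub_lt.
  have pk i : p (`|k - k0| + i)%N = (k%:~R + i%:R) * l.
    by rewrite /p -(intrD _ k i%:Z); congr (_%:~R * _); exact: absz_subK.
  case: b Hb => Hb.
    exists `|k - k0|%N; first by rewrite (leq_trans Nlt)// /N addn4 ltnW// ltnW.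
    have := Hb (x - k%:~R * l); rewrite -[X in p X]addn0 pk addr0 expr1.
    have -> : x + -1 * (x - k%:~R * l) = k%:~R * l by ring.
    by apply; apply/andP; split; lra.
  exists (`|k - k0| + 1)%N; first by rewrite addn1 /N addn4 ltnS (leq_trans Nlt).
  have := Hb ((k%:~R + 1) * l - x); rewrite pk expr0.
  have -> : x + 1 * ((k%:~R + 1) * l - x) = (k%:~R + 1) * l by ring.
  by apply; apply/andP; split; lra.
- have B := @Boole_inequality _ _ _ mu W N (fun i _ => mW i).
  apply: (le_trans B) => {B}.
  apply: (@le_trans _ _ (\sum_(i < N) (2 * w)%:E)%E).
    by apply: lee_sum => i _; exact: muW.
  rewrite sumEFin lee_fin sumr_const card_ord -[X in X <= _]mulr_natl ler_wpM2r//.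
    by rewrite mulr_ge0// ltW.
  rewrite natrD lerD2r truncn_le divr_ge0 ?mulr_ge0// ltW//.
Qed.

Variables (s : R) (N0 : nat).
Hypothesis s01 : 0 <= s <= 1.
Hypothesis mass : forall n, (N0 <= n)%N ->
  1 <= (ncyl n.+1)%:R * (cyl_len n.+1 * (m n.+1)%:R) `^ s.

(** For [cyl_len n.+1 <= r < cyl_len n], [preimage_ball] at level [n] bounds the
    preimage of the ball by [12 / M] with [M = ncyl n.+1], and at level [n.+1] by
    [12 / M * (r / q)] with [q = cyl_len n.+1 * m n.+1]. The smaller of the two is
    at most [12 / M * (r / q) ^ s], and [mass] says that [q ^ - s <= M]. *)
Lemma preimage_ball_powR x0 r : 0 < r < cyl_len N0 -> exists V : set R,
  [/\ measurable V, forall y, 0 <= y < 1 -> `|g y - x0| <= r -> V y &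
  (mu V <= (12 * r `^ s)%:E)%E].
Proof.
move=> /andP[r0 rN0].
have [n [nN nr rn]] : exists n, [/\ (N0 <= n)%N, r < cyl_len n & cyl_len n.+1 <= r].
  have ex : exists n, (N0 < n)%N && (cyl_len n <= r).
    exists (Num.truncn r^-1 + N0.+1)%N; rewrite addnS ltnS leq_addl /=.
    apply: le_trans (cyl_len_le _) _.
    rewrite -[X in _ <= X]invrK lef_pV2 ?posrE ?invr_gt0//.
    have /andP[_ /ltW] : (Num.truncn r^-1)%:R <= r^-1 < (Num.truncn r^-1).+1%:R.
      by apply: truncn_itv; rewrite invr_ge0 ltW.
    by move=> /le_trans; apply; rewrite ler_nat; lia.
  case: (ex_minnP ex) => -[//|n] /andP[nN nr] nmin.
  exists n; split => //; move: nN; rewrite ltnS leq_eqVlt => /orP[/eqP <-//|nN].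
  by rewrite ltNge; apply/negP => rn; have := nmin n; rewrite nN rn ltnn => /(_ isT).
pose M : R := (ncyl n.+1)%:R; have M0 : 0 < M by rewrite ltr0n ncyl_gt0.
pose q : R := cyl_len n.+1 * (m n.+1)%:R.
have mR : (0 : R) < (m n.+1)%:R by rewrite ltr0n.
have q0 : 0 < q by rewrite mulr_gt0// cyl_len_gt0.
have Mq : M^-1 <= q `^ s.
  by rewrite -[_^-1]mul1r ler_pdivrMr// mulrC; exact: mass.
have rq : r `^ s = q `^ s * (r / q) `^ s.
  by rewrite -powRM ?(ltW q0) ?divr_ge0 ?(ltW r0) ?(ltW q0)// mulrC divfK// gt_eqF.
have bound V' : V' <= 12 * M^-1 * (r / q) `^ s -> V' <= 12 * r `^ s.
  move=> /le_trans; apply; rewrite rq -mulrA ler_pM2l// ler_wpM2r//.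
  exact: powR_ge0.
have rq0 : 0 < r / q by rewrite divr_gt0.
have /andP[s0 s1] := s01.
have [rqle|rqgt] := leP (r / q) 1.
  have [V [mV VP Vle]] := preimage_ball n.+1 x0 (ltW r0).
  exists V; split => //; apply: le_trans Vle _; rewrite lee_fin; apply: bound.
  have l0 := cyl_len_gt0 n.+1.
  apply: (@le_trans _ _ (12 * M^-1 * (r / q))); last first.
    rewrite ler_pM2l ?mulr_gt0 ?invr_gt0//.
    rewrite -[X in X <= _]powRr1 ?(ltW rq0)//.
    by apply: ger_powR => //; rewrite rq0.
  have -> : 12 * M^-1 * (r / q) = (12 * (r / cyl_len n.+1)) / (ncyl n.+2)%:R.
    rewrite [ncyl n.+2]/ncyl big_ord_recr /= -/(ncyl n.+1) natrM -/M /q.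
    by field; rewrite !gt_eqF.
  rewrite [X in X <= _]mulrA ler_wpM2r ?invr_ge0//.
  have : 1 <= r / cyl_len n.+1 by rewrite ler_pdivlMr// mul1r.
  by rewrite -(mulrA 2 r); move: (r / _) => t *; lra.
have [V [mV VP Vle]] := preimage_ball n x0 (ltW r0).
exists V; split => //; apply: le_trans Vle _; rewrite lee_fin; apply: bound.
have l0 := cyl_len_gt0 n.
apply: (@le_trans _ _ (12 * M^-1)); last first.
  rewrite ler_peMr ?mulr_ge0 ?invr_ge0 ?(ltW M0)//.
  by rewrite -[X in X <= _](powRr0 (r/q)) ler_powR// ltW.
rewrite [X in X <= _]mulrA -/M ler_wpM2r ?invr_ge0 ?(ltW M0)//.
have : r / cyl_len n <= 1 by rewrite ler_pdivrMr// mul1r ltW.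
by rewrite -(mulrA 2 r); move: (r / _) => t *; lra.
Qed.

Lemma preimage_cover (U : set R) : (diam U <= (cyl_len N0 / 2)%:E)%E ->
  exists V : set R, [/\ measurable V, forall y, 0 <= y < 1 -> U (g y) -> V y &
  (mu V <= 12%:E * diam_pow s U)%E].
Proof.
move=> Ud; have [[y0 [y01 Uy0]]|no] := pselect (exists y, 0 <= y < 1 /\ U (g y)); last first.
  exists set0; split; [exact: measurable0| |].
    by move=> y y01 Uy; apply: no; exists y.
  by rewrite measure0 mule_ge0// diam_pow_ge0.
have l0 := cyl_len_gt0 N0.
have [r rE] : exists r, diam U = r%:E.
  have := diam_ge0 U; case: (diam U) Ud => [r _ _|//|//]; by exists r.
have r0 : 0 <= r by rewrite -lee_fin -rE diam_ge0.
have Ur y : U (g y) -> `|g y - g y0| <= r.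
  by move=> Uy; rewrite -lee_fin -rE; exact: dist_le_diam.
have -> : (12%:E * diam_pow s U = (12 * r `^ s)%:E)%E.
  rewrite /diam_pow ifF ?rE//; apply/negP => /eqP U0.
  by move: Uy0; rewrite U0.
move: r0; rewrite le_eqVlt => /orP[/eqP r0|r0].
  exists [set y0]; split; first exact: measurable_set1.
    move=> y yI Uy; have := Ur _ Uy; rewrite -r0 normr_le0 subr_eq0 => /eqP gyy.
    have dn n : `|y - y0| <= (ncyl n)%:R^-1.
      by apply: block_map_dist => // i _; rewrite gyy.
    apply/eqP; rewrite -subr_eq0 -normr_le0 leNgt; apply/negP => d0.
    have := dn (Num.truncn (`|y - y0|)^-1).+1; apply/negP; rewrite -ltNge.
    rewrite -[X in _ < X]invrK ltf_pV2 ?posrE ?invr_gt0 ?ltr0n ?ncyl_gt0//.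
    have /andP[_ /lt_le_trans] : (Num.truncn (`|y - y0|)^-1)%:R <= (`|y - y0|)^-1
        < (Num.truncn (`|y - y0|)^-1).+1%:R by apply: truncn_itv; rewrite invr_ge0.
    by apply; rewrite ler_nat ltnW// ncyl_ge.
  by rewrite lebesgue_measure_set1 lee_fin mulr_ge0// powR_ge0.
have [|V [mV VP Vle]] := @preimage_ball_powR (g y0) r.
  by rewrite r0 /=; move: Ud; rewrite rE lee_fin => h; lra.
by exists V; split => // y yI /Ur; exact: VP.
Qed.

(** A cover of [block_set] with small sum would pull back to a cover of [[0, 1)]
    of total Lebesgue measure less than 1. *)
Lemma block_set_measure_neq0 : hausdorff_measure s block_set <> 0.
Proof.
move=> H.
have d0 : 0 < cyl_len N0 / 2 by rewrite divr_gt0 ?cyl_len_gt0.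
have e0 : (0 : R) < 1 / 12 by lra.
have [U [KU Ud Ue]] := hausdorff_measure_eq0_cover d0 e0 H.
have /choice[V VP] : forall k, exists V : set R, [/\ measurable V,
    forall y, 0 <= y < 1 -> U k (g y) -> V y &
    (mu V <= 12%:E * diam_pow s (U k))%E].
  by move=> k; exact: preimage_cover.
have E := lebesgue_measure_itv (`[(0 : R), 1[); rewrite /= lte_fin ltr01 in E.
pose I01 : set R := [set` `[(0 : R), 1[].
have : (mu I01 <= \sum_(0 <= k <oo) mu (V k))%E.
  apply: measure_sigma_subadditive.
  - by move=> k; case: (VP k).
  - exact: measurable_itv.
  - move=> y; rewrite /I01 /= in_itv /= => y01.
    have [k _ Uk] := KU _ (block_mapP y01).
    by exists k => //; case: (VP k) => _ + _; apply.
apply/negP; rewrite -ltNge /I01 E oppr0 adde0.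
apply: (@le_lt_trans _ _ (\sum_(0 <= k <oo) 12%:E * diam_pow s (U k))%E).
  by apply: lee_nneseries => [k _ _|k _]; [exact: measure_ge0|case: (VP k)].
rewrite nneseriesZl; last by move=> *; exact: diam_pow_ge0.
have -> : (1%:E = 12%:E * (1 / 12)%:E :> \bar R)%E.
  by rewrite -EFinM; congr EFin; field.
by rewrite lte_pmul2l.
Qed.

End LowerBound.

Lemma hausdorff_measure_block_set {R : realType} (m : nat -> nat) (s : R) (N0 : nat) :
  (forall n, 2 <= m n)%N -> (forall n, m n <= m n.+1)%N -> 0 <= s <= 1 ->
  (forall n, (N0 <= n)%N ->
     1 <= (ncyl m n.+1)%:R * (cyl_len m n.+1 * (m n.+1)%:R) `^ s) ->
  hausdorff_measure s (block_set m) <> 0.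
Proof.
move=> m2 mnd s01 H; have [g gP] := @block_map R m m2 mnd.
exact: (block_set_measure_neq0 m2 gP s01 H).
Qed.

(** * Covers by cylinders *)

Lemma ffact_leq_expn n k : (n ^_ k <= n ^ k)%N.
Proof.
rewrite ffact_prod -[k in X in (_ <= X)%N]card_ord -prod_nat_const.
by apply: leq_prod => i _; exact: leq_subr.
Qed.

Section UpperBound.
Context {R : realType}.
Implicit Types (x y s e : R) (al be : nat -> R) (n i N : nat).

Definition growth_set al be N : set R := [set x | pierce_dom x /\
  forall n, (N <= n)%N -> al n <= ln (dig n x)%:R <= be n].

Lemma ln_dig_expR n x : pierce_dom x -> (dig n x)%:R = expR (ln (dig n x)%:R) :> R.
Proof. by move=> xd; rewrite lnK// posrE ltr0n dig_gt0. Qed.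

Lemma growth_set_dist al be N n x y : (N <= n)%N ->
  growth_set al be N x -> growth_set al be N y ->
  (forall i, (i < n)%N -> dig i x = dig i y) ->
  `|x - y| <= expR (- \sum_(N <= i < n.+1) al i).
Proof.
move=> Nn [xd xg] [yd yg] H.
have inv_dig (z : R) : pierce_dom z -> al n <= ln (dig n z)%:R -> (dig n z)%:R^-1 <= expR (- al n).
  by move=> zd h; rewrite ln_dig_expR// -expRN ler_expR lerN2.
have := pierce_dist xd yd H; set P := \prod_(i < n) _.
have P0 : expR (\sum_(N <= i < n) al i) <= P.
  rewrite /P -(big_mkord xpredT (fun i => (dig i x)%:R)) (big_cat_nat (leq0n N) Nn) /=.
  rewrite -[X in X <= _]mul1r; apply: ler_pM => //.
    rewrite -natr_prod ler1n prodn_gt0// => i; exact: dig_gt0.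
  rewrite expR_sum !big_nat; apply: ler_prod => i /andP[Ni _].
  by rewrite expR_ge0 [X in _ <= X]ln_dig_expR// ler_expR; case/andP: (xg i Ni).
move=> h; rewrite big_nat_recr //= opprD expRD expRN mulrC.
rewrite ler_pdivlMr ?expR_gt0//.
apply: (@le_trans _ _ (`|x - y| * P)); first by rewrite ler_wpM2l.
apply: (le_trans h); rewrite ge_max !inv_dig//.
  by case/andP: (yg n Nn).
by case/andP: (xg n Nn).
Qed.

Lemma dig_le_truncn al be N x i : growth_set al be N x ->
  (dig i x <= Num.truncn (expR (be (maxn N i))))%N.
Proof.
move=> [xd xg]; apply: (@leq_trans (dig (maxn N i) x)).
  have := leq_maxr N i; rewrite leq_eqVlt => /orP[/eqP {1}->//|/(dig_lt xd)].
  exact: ltnW.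
rewrite truncn_ge_nat ?expR_ge0// ln_dig_expR// ler_expR.
by case/andP: (xg _ (leq_maxl N i)).
Qed.

(** The [i]-th digit has at most [expR (be (maxn N i))] possible values: for
    [i < N] it is bounded by the digit of index [N]. The strings of length [n] are
    counted by the product of these numbers, whatever their monotonicity; the loss
    is negligible when the digits grow fast. *)
Lemma growth_set_null_prod al be N s : 0 < s -> (forall n, 0 <= be n) ->
  (forall e, 0 < e -> exists2 n, (N <= n)%N &
     expR (\sum_(i < n) be (maxn N i)) *
     expR (- \sum_(N <= i < n.+1) al i) `^ s <= e) ->
  hausdorff_measure s (growth_set al be N) = 0.
Proof.
move=> s0 be0 H; apply: hausdorff_measure_eq0_code => // e /H[n Nn He].
pose b i := Num.truncn (expR (be (maxn N i))).
(* [(b i).-1.+1] is [b i], but makes the ordinal type inhabited for [inord]. *)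
have b0 i : (0 < b i)%N by rewrite truncn_gt_nat -expR0 ler_expR be0.
exists {dffun forall i : 'I_n, 'I_(b i).-1.+1}, xpredT,
  (fun x => [ffun i : 'I_n => inord (dig i x).-1 : 'I_(b i).-1.+1]),
  (expR (- \sum_(N <= i < n.+1) al i)).
split=> //.
- move=> x y xA yA /ffunP E; apply: (growth_set_dist _ xA yA) => // i ni.
  have := E (Ordinal ni); rewrite !ffunE => /(congr1 val) /=.
  have := dig_le_truncn i xA; have := dig_le_truncn i yA; rewrite -/(b i) => yb xb.
  have := dig_gt0 i xA.1; have := dig_gt0 i yA.1 => y0 x0.
  have predlt k : (0 < k)%N -> (k <= b i)%N -> (k.-1 < (b i).-1.+1)%N.
    by move=> k0 kb; rewrite !prednK.
  rewrite !inordK ?predlt//.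
  by move=> E'; rewrite -(prednK x0) -(prednK y0) E'.
- apply: le_trans He; rewrite ler_wpM2r ?powR_ge0//.
  rewrite (@eq_card _ _ (mem {: {dffun forall i : 'I_n, 'I_(b i).-1.+1}}))//.
  rewrite card_dep_ffun.
  rewrite foldrE big_map enumT -/(index_enum _) expR_sum natr_prod.
  apply: ler_prod => i _; rewrite ler0n card_ord prednK// truncn_le.
  exact: expR_ge0.
Qed.

(** Here the strings of length [n.+1] are counted by a binomial coefficient, as
    they are increasing and bounded by the last admissible digit. The factor
    [(n.+1)`!] gained in this way decides when the digits grow polynomially. *)
Lemma growth_set_null_binom al be N s : 0 < s -> (forall n, 0 <= be n) ->
  (forall e, 0 < e -> exists2 n, (N <= n)%N &
     (2 * expR (be n)) ^+ n.+1 / (n.+1)`!%:R *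
     expR (- \sum_(N <= i < n.+2) al i) `^ s <= e) ->
  hausdorff_measure s (growth_set al be N) = 0.
Proof.
move=> s0 be0 H; apply: hausdorff_measure_eq0_code => // e /H[n Nn He].
pose b := Num.truncn (expR (be n)).
exists (n.+1.-tuple 'I_b.+1), (fun t : n.+1.-tuple 'I_b.+1 => sorted ltn (map val t)),
  (fun x => [tuple inord (dig i x) | i < n.+1]), (expR (- \sum_(N <= i < n.+2) al i)).
have digb i x : (i < n.+1)%N -> growth_set al be N x -> (dig i x < b.+1)%N.
  move=> ni xA; rewrite ltnS; apply: (@leq_trans (dig n x)).
    move: ni; rewrite ltnS leq_eqVlt => /orP[/eqP->//|/(dig_lt xA.1)]; exact: ltnW.
  by have := dig_le_truncn n xA; rewrite (maxn_idPr Nn).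
split=> //.
- move=> x xA; rewrite unfold_in /= -map_comp.
  have -> : map (val \o (fun i : 'I_n.+1 => inord (dig i x) : 'I_b.+1)) (ord_tuple n.+1)
      = map (dig ^~ x) (iota 0 n.+1).
    rewrite -(val_enum_ord n.+1) -map_comp [LHS]/(map _ _) val_ord_tuple.
    apply: eq_map => i /=.
    by rewrite inordK// digb.
  rewrite sorted_map; apply: (@sub_sorted _ ltn); last exact: iota_ltn_sorted.
  by move=> i j /= ij; apply: dig_lt => //; exact: xA.1.
- move=> x y xA yA E; apply: (growth_set_dist _ xA yA) => //; first exact: leq_trans Nn _.
  move=> i ni; have := congr1 (fun t => val (tnth t (Ordinal ni))) E.
  by rewrite !tnth_mktuple /= !inordK ?digb.
- apply: le_trans He; rewrite ler_wpM2r ?powR_ge0// -cardsE card_ltn_sorted_tuples.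
  rewrite ler_pdivlMr ?ltr0n ?fact_gt0// -natrM bin_ffact.
  apply: (@le_trans _ _ ((b.+1 ^ n.+1)%N%:R)).
    by rewrite ler_nat; exact: ffact_leq_expn.
  rewrite natrX ler_pXn2r ?nnegrE ?mulr_ge0 ?expR_ge0//.
  have : (1 : R) <= expR (be n) by rewrite -expR0 ler_expR.
  have : b%:R <= expR (be n) by rewrite truncn_le expR_ge0.
  by rewrite -natr1; lra.
Qed.

End UpperBound.

(** * Elementary asymptotics *)

Section Asymptotics.
Context {R : realType}.
Implicit Types (f a b : nat -> R) (c e s x y : R) (n i k : nat).

Lemma expR_powR x s : expR x `^ s = expR (x * s).
Proof. by rewrite /powR gt_eqF ?expR_gt0// expRK mulrC. Qed.

Lemma near_ge_natr c : \forall n \near \oo, c <= n%:R.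
Proof. exact: nbhs_infty_ger. Qed.

Lemma ln_natS_le e : 0 < e -> \forall n \near \oo, ln n.+2%:R <= e * n%:R.
Proof.
move=> e0; near=> n.
have n2 : (2 : R) <= n%:R by near: n; exact: near_ge_natr.
have ne : 8 / e ^+ 2 <= n%:R by near: n; exact: near_ge_natr.
rewrite -ler_expR lnK ?posrE//.
have h : 1 + e * n%:R / 2 <= expR (e * n%:R / 2) by exact: expR_ge1Dx.
have -> : expR (e * n%:R) = expR (e * n%:R / 2) ^+ 2.
  by rewrite expr2 -expRD; congr expR; field.
have p0 : 0 < e * n%:R by rewrite mulr_gt0//; lra.
apply: (@le_trans _ _ ((1 + e * n%:R / 2) ^+ 2)); last first.
  by rewrite ler_pXn2r ?nnegrE ?expR_ge0//; lra.
rewrite ler_pdivrMr ?exprn_gt0// in ne.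
rewrite -addn2 natrD.
have -> : (1 + e * n%:R / 2) ^+ 2 = 1 + e * n%:R + n%:R * (n%:R * e ^+ 2) / 4 by field.
have : n%:R * 8 <= n%:R * (n%:R * e ^+ 2) by rewrite ler_wpM2l.
by lra.
Unshelve. all: by end_near. Qed.

Lemma near_ln_ge c : \forall n \near \oo, c <= ln n.+1%:R.
Proof.
near=> n; rewrite -ler_expR lnK ?posrE//.
have : expR c <= n%:R by near: n; exact: near_ge_natr.
by move=> /le_trans; apply; rewrite ler_nat.
Unshelve. all: by end_near. Qed.

Lemma sum_le_near a b : (\forall n \near \oo, a n <= b n) ->
  exists c, forall n, \sum_(i < n) a i <= c + \sum_(i < n) b i.
Proof.
move=> [N _ ab]; exists (\sum_(i < N) `|a i - b i|) => n.
have H k : \sum_(i < k) a i <= \sum_(i < minn k N) `|a i - b i| + \sum_(i < k) b i.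
  elim: k => [|k IH]; first by rewrite min0n !big_ord0 addr0.
  rewrite !big_ord_recr /=; case: (ltnP k N) => kN.
    rewrite (minn_idPl kN) (minn_idPl (ltnW kN)) in IH *.
    by rewrite big_ord_recr /=; have := ler_norm (a k - b k); lra.
  rewrite (minn_idPr kN) in IH; rewrite (minn_idPr (leqW kN)).
  by have := ab k kN; lra.
apply: le_trans (H n) _; rewrite lerD2r.
rewrite -!(big_mkord xpredT (fun i => `|a i - b i|)).
rewrite [X in _ <= X](@big_cat_nat _ _ _ (minn n N)) ?geq_minr//= lerDl.
by rewrite sumr_ge0.
Qed.

Lemma sum_nd_ge f n : (forall i, f i <= f i.+1) -> n%:R * f 0%N <= \sum_(i < n) f i.
Proof.
move=> fnd; have f0 i : f 0%N <= f i.
  by elim: i => // i IH; exact: le_trans IH (fnd i).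
elim: n => [|n IH]; first by rewrite mul0r big_ord0.
by rewrite big_ord_recr /= -natr1 mulrDl mul1r lerD.
Qed.

Lemma near_sum_ge f c : (forall i, 0 < f i) -> (forall i, f i <= f i.+1) ->
  \forall n \near \oo, c <= \sum_(i < n) f i.
Proof.
move=> f0 fnd; near=> n.
apply: le_trans (sum_nd_ge _ fnd); rewrite -ler_pdivrMr//.
by near: n; exact: near_ge_natr.
Unshelve. all: by end_near. Qed.

Definition lnfact n : R := \sum_(i < n) ln i.+1%:R.

Lemma natr_fact_expR n : (n`!)%:R = expR (lnfact n).
Proof.
elim: n => [|n IH]; first by rewrite /lnfact big_ord0 expR0.
by rewrite /lnfact big_ord_recr /= expRD -/(lnfact n) -IH factS natrM mulrC lnK ?posrE.
Qed.

Lemma lnfact_ge n : n%:R * ln n%:R - n%:R <= lnfact n.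
Proof.
elim: n => [|n IH]; first by rewrite /lnfact big_ord0 mul0r subr0.
rewrite /lnfact big_ord_recr /= -/(lnfact n).
case: n IH => [|n] IH; first by rewrite ln1 mulr0 addr0; have := IH; lra.
have h : ln n.+2%:R - ln n.+1%:R <= (n.+1%:R)^-1 :> R.
  rewrite -ln_div ?posrE//.
  have -> : n.+2%:R / n.+1%:R = 1 + (n.+1%:R)^-1 :> R.
    by rewrite -(natr1 n.+1); field.
  by apply: le_ln1Dx; rewrite (lt_le_trans _ (_ : 0 <= _))// invr_ge0.
have : n.+1%:R * (ln n.+2%:R - ln n.+1%:R) <= 1 :> R.
  by rewrite -ler_pdivlMl// mulr1.
rewrite mulrBr -(natr1 n.+1) => h2; lra.
Qed.

End Asymptotics.

(** * Upper bounds for the dimension *)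

Section UpperTheorems.
Context {R : realType}.
Implicit Types (f a b : nat -> R) (c e s x y t : R) (n i k : nat).

(** Since [S n] tends to infinity, constants and the finitely many indices below
    [N] are absorbed, and the exponent in [growth_set_null_prod] is at most a
    constant minus [(s * (1 - e) * (1 + t) - (1 + e)) * S n] at every index [n] such
    that [t * S n <= f n]. *)
Lemma growth_set_null_fast f (N : nat) s t e :
  (forall i, 0 < f i) -> (forall i, f i <= f i.+1) ->
  0 < s -> 0 < e < 1 -> 1 + e < s * (1 - e) * (1 + t) ->
  (forall K, exists2 n, (K <= n)%N & t * \sum_(i < n) f i <= f n) ->
  hausdorff_measure s (growth_set (fun i => (1 - e) * f i)
                                  (fun i => (1 + e) * f i) N) = 0.
Proof.
move=> f0 fnd s0 /andP[e0 e1] st Ht.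
pose S n := \sum_(i < n) f i.
have fmono i j : (i <= j)%N -> f i <= f j.
  move=> ij; rewrite -(subnKC ij); elim: (j - i)%N => [|k IH]; first by rewrite addn0.
  by rewrite addnS; exact: le_trans IH (fnd _).
apply: growth_set_null_prod => //.
  by move=> n; rewrite mulr_ge0 ?(ltW (f0 n))//; lra.
move=> d d0.
pose k := s * (1 - e) * (1 + t) - (1 + e); have k0 : 0 < k by rewrite /k; lra.
have [c1 hc1] : exists c, forall n, \sum_(i < n) f (maxn N i) <= c + S n.
  apply: (@sum_le_near _ (fun i => f (maxn N i)) f); exists N => // i /= Ni.
  by rewrite (maxn_idPr Ni).
pose c := (1 + e) * c1 + s * (1 - e) * S N.
have Sunb (M : R) : forall K, exists2 n, (K <= n)%N & (N <= n)%N /\ (M <= S n /\ t * S n <= f n).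
  move=> K; have [K' _ HK'] := near_sum_ge M f0 fnd.
  have [n Kn tn] := Ht (maxn K (maxn K' N)).
  exists n; first by apply: leq_trans Kn; exact: leq_maxl.
  split; first by apply: leq_trans Kn; rewrite !leq_max leqnn !orbT.
  split=> //; apply: HK'; apply: leq_trans Kn => /=.
  by rewrite !leq_max leqnn !orbT.
have [n _ [Nn [Mn tn]]] := Sunb ((c - ln d) / k) N.
exists n => //; rewrite expR_powR -expRD -[X in _ <= X]lnK ?posrE// ler_expR.
rewrite -mulr_sumr -big_distrr /=.
have -> : \sum_(N <= i < n.+1) f i = S n + f n - S N.
  rewrite big_nat_recr//= /S -!(big_mkord xpredT f).
  by rewrite [in RHS](big_cat_nat (leq0n N) Nn) /=; ring.
have h1 : (1 + e) * \sum_(i < n) f (maxn N i) <= (1 + e) * (c1 + S n).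
  by rewrite ler_pM2l ?hc1//; lra.
have h2 : s * (1 - e) * (t * S n) <= s * (1 - e) * f n.
  by rewrite ler_wpM2l// mulr_ge0 ?ltW//; lra.
have h3 : c - ln d <= k * S n by rewrite mulrC -ler_pdivrMr.
by move: h3; rewrite /c /k; lra.
Qed.

(** With [p = n.+1], Stirling's lower bound for [p`!] makes the exponent in
    [growth_set_null_binom] at most [(b - 1 - s * a) * p * ln p + O(p)]. *)
Lemma growth_set_null_poly (a b s : R) N : 0 < s -> 0 <= b -> b - 1 < s * a -> 0 <= a ->
  hausdorff_measure s (growth_set (fun i => a * ln i.+1%:R)
                                  (fun i => b * ln i.+1%:R) N) = 0.
Proof.
move=> s0 b0 bs a0; apply: growth_set_null_binom => //.
  by move=> n; rewrite mulr_ge0// ln_ge0// ler1n.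
move=> d d0; pose k := 1 + s * a - b; have k0 : 0 < k by rewrite /k; lra.
pose c := s * (a * lnfact N) : R.
have : \forall n \near \oo, (N <= n)%N /\
    (ln 2 + 1 + s * a + 1) / k <= ln n.+1%:R /\ c - ln d <= n%:R.
  near=> n; split; first by near: n; exact: nbhs_infty_ge.
  by split; near: n; [exact: near_ln_ge|exact: near_ge_natr].
move=> [n0 _ /(_ n0 (leqnn _))]; move: n0 => n [Nn [h1 h2]]; exists n => //.
rewrite expR_powR natr_fact_expR -expRN.
have -> : (2 * expR (b * ln n.+1%:R)) ^+ n.+1 =
    expR (n.+1%:R * (ln 2 + b * ln n.+1%:R)) :> R.
  by rewrite expRM_natl expRD lnK ?posrE.
rewrite -!expRD -[X in _ <= X]lnK ?posrE// ler_expR -big_distrr /=.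
have h3 : lnfact n.+1 - lnfact N <= \sum_(N <= i < n.+2) ln i.+1%:R :> R.
  rewrite big_nat_recr//=; last exact: leq_trans Nn _.
  rewrite /lnfact -!(big_mkord xpredT (fun i => ln i.+1%:R : R)).
  rewrite [X in X - _](big_cat_nat (leq0n N) (leqW Nn)) /= addrAC subrr add0r.
  by rewrite lerDl ln_ge0// ler1n.
have h4 : s * a * (lnfact n.+1 - lnfact N) <=
    s * a * \sum_(N <= i < n.+2) ln i.+1%:R.
  by rewrite ler_wpM2l// mulr_ge0// ltW.
have h5 : (1 + s * a) * (n.+1%:R * ln n.+1%:R - n.+1%:R) <= (1 + s * a) * lnfact n.+1.
  by rewrite ler_wpM2l ?lnfact_ge// addr_ge0// mulr_ge0// ltW.
have h6 : n.+1%:R * (ln 2 + 1 + s * a + 1) <= n.+1%:R * (k * ln n.+1%:R).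
  by rewrite ler_wpM2l// [k * _]mulrC -ler_pdivrMr.
have h7 : (n%:R : R) <= n.+1%:R by rewrite ler_nat.
by rewrite /k /c in h6 h2 *; lra.
Unshelve. all: by end_near. Qed.

End UpperTheorems.

(** * Blocks of prescribed logarithmic size *)

Section LowerTheorem.
Context {R : realType}.
Variables (psi : nat -> R) (th xi : R).
Hypothesis psi_nd : forall i, psi i <= psi i.+1.
Hypothesis th_ge0 : 0 <= th.
Hypothesis psi_th : \forall n \near \oo, ln n.+1%:R <= th * psi n.
Implicit Types (c e s x y t : R) (n i k : nat).

(** The maximum with 2 changes finitely many terms only, as [psi] tends to
    infinity; it makes every level of the Cantor set branch. *)
Definition block_size n : nat := maxn 2 (Num.truncn (expR (psi n))).
Local Notation m := block_size.
Local Notation mu n := (ln (m n)%:R : R).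

Lemma block_size_ge2 n : (2 <= m n)%N.
Proof. exact: leq_maxl. Qed.

Lemma block_size_nd n : (m n <= m n.+1)%N.
Proof.
rewrite geq_max !leq_max leqnn /=; apply/orP; right.
by rewrite le_truncn// ler_expR.
Qed.

(** [psi] is unbounded because it dominates the logarithm. *)
Lemma near_psi_ge c : \forall n \near \oo, c <= psi n.
Proof.
pose d := Num.max c 1; have d1 : 1 <= d by rewrite le_max lexx orbT.
near=> n; apply: (@le_trans _ _ d); first by rewrite le_max lexx.
have h1 : d * (th + 1) <= ln n.+1%:R by near: n; exact: near_ln_ge.
have h2 : ln n.+1%:R <= th * psi n by near: n; exact: psi_th.
have th0 : 0 < th.
  rewrite lt_neqAle th_ge0 andbT; apply/eqP => th0.
  by move: h1 h2; rewrite -th0; lra.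
rewrite -(ler_pM2l th0); lra.
Unshelve. all: by end_near. Qed.

Lemma near_ln_block_size : \forall n \near \oo, psi n - ln 2 <= mu n <= psi n.
Proof.
near=> n; have h : ln 2 <= psi n by near: n; exact: near_psi_ge.
have e2 : 2 <= expR (psi n) by rewrite -[X in X <= _]lnK ?posrE// ler_expR.
have t2 : (2 <= Num.truncn (expR (psi n)))%N by rewrite truncn_ge_nat ?expR_ge0.
rewrite /m (maxn_idPr t2); set t := Num.truncn _ in t2 *.
have /andP[t3 t4] : t%:R <= expR (psi n) < t.+1%:R by apply: truncn_itv; exact: expR_ge0.
have t0 : (0 : R) < t%:R by rewrite ltr0n ltnW.
have tR : (2 : R) <= t%:R by rewrite ler_nat.
apply/andP; split; last by rewrite -[X in _ <= X]expRK ler_ln ?posrE ?expR_gt0.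
rewrite lerBlDr -lnM ?posrE// -[X in X <= _]expRK ler_ln ?posrE ?expR_gt0 ?mulr_gt0//.
by rewrite -natr1 in t4; lra.
Unshelve. all: by end_near. Qed.

Lemma block_set_ln_dig : \forall n \near \oo, forall x, block_set m x ->
  `|ln (dig n x)%:R - (ln n.+1%:R + psi n)| <= ln 2.
Proof.
near=> n => x [xd /(_ n)/andP[h1 h2]].
have /andP[m1 m2] : psi n - ln 2 <= mu n <= psi n by near: n; exact: near_ln_block_size.
have m0 : (0 : R) < (m n)%:R by rewrite ltr0n ltnW// block_size_ge2.
have d0 : (0 : R) < (dig n x)%:R by rewrite ltr0n dig_gt0.
have g1 : ln n.+1%:R + mu n <= ln (dig n x)%:R.
  by rewrite -lnM ?posrE// ler_ln ?posrE ?mulr_gt0// -natrM ler_nat.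
have g2 : ln (dig n x)%:R <= ln n.+1%:R + ln 2 + mu n.
  rewrite -!lnM ?posrE ?mulr_gt0// ler_ln ?posrE ?mulr_gt0// -!natrM ler_nat.
  by apply: leq_trans (ltnW h2) _; rewrite leq_mul2r muln2 -addnn addSn addnS !ltnS leq_addr orbT.
by rewrite ler_norml; apply/andP; split; lra.
Unshelve. all: by end_near. Qed.

Hypothesis xi_ge0 : 0 <= xi.
Hypothesis psi_xi : \forall n \near \oo, psi n <= xi * \sum_(i < n) psi i.

(** Taking logarithms, the mass condition at level [n] reads
    [s * (2 * ln (n + 2) + ln (m n) + sum_(i < n) ln (i + 2) + T n + O(1)) <= T n],
    where [T n] is the sum of the [ln (m i)], [i < n]. Relative to [T n] the terms in
    the bracket are asymptotically at most [0], [xi], [th] and [1], so that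
    [s * (1 + th + xi) < 1] leaves room for an error [e] in each of them. *)
Lemma hausdorff_measure_block_size s : 0 <= s -> s * (1 + th + xi) < 1 ->
  hausdorff_measure s (block_set m : set R) <> 0.
Proof.
move=> s0 sth.
have s1 : s <= 1.
  by have : 0 <= s * (th + xi) by [rewrite mulr_ge0// addr_ge0]; lra.
pose T n := \sum_(i < n) mu i; pose Psi n := \sum_(i < n) psi i.
pose e := (1 - s * (1 + th + xi)) / 4.
have e0 : 0 < e by rewrite /e; lra.
have e4 : 4 * e = 1 - s * (1 + th + xi) by rewrite /e; field.
clearbody e.
have [c1 hc1] : exists c, forall n, (1 - e) * Psi n <= c + T n.
  have [|c hc] := @sum_le_near _ (fun i => (1 - e) * psi i) (fun i => mu i).
    near=> n; have /andP[h _] : psi n - ln 2 <= mu n <= psi n.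
      by near: n; exact: near_ln_block_size.
    have : ln 2 / e <= psi n by near: n; exact: near_psi_ge.
    by rewrite ler_pdivrMr//; lra.
  by exists c => n; rewrite /Psi mulr_sumr; exact: hc.
have [c2 hc2] : exists c, forall n, \sum_(i < n) ln i.+2%:R <= c + (th + e) * Psi n.
  have [|c hc] := @sum_le_near _ (fun i => ln i.+2%:R) (fun i => (th + e) * psi i).
    near=> n; have h : ln n.+1%:R <= th * psi n by near: n; exact: psi_th.
    have : ln 2 / e <= psi n by near: n; exact: near_psi_ge.
    rewrite ler_pdivrMr// => h2.
    apply: (@le_trans _ _ (ln n.+1%:R + ln 2)); last lra.
    rewrite -lnM ?posrE// ler_ln ?posrE ?mulr_gt0// -natrM ler_nat; lia.
  by exists c => n; rewrite /Psi mulr_sumr; exact: hc.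
have [c3 hc3] : exists c, forall n, n%:R <= c + Psi n.
  have [|c hc] := @sum_le_near _ (fun i => 1) psi; first exact: near_psi_ge.
  by exists c => n; have := hc n; rewrite sumr_const card_ord.
have [N0 _ HN] : \forall n \near \oo,
    s * (ln 4 + 2 * ln n.+2%:R + mu n + \sum_(i < n) ln i.+2%:R + T n) <= T n.
  near=> n.
  have h1 : psi n <= xi * Psi n by near: n; exact: psi_xi.
  have /andP[_ h2] : psi n - ln 2 <= mu n <= psi n.
    by near: n; exact: near_ln_block_size.
  have h3 : ln n.+2%:R <= (e / 2) * n%:R by near: n; apply: ln_natS_le; rewrite divr_gt0.
  pose C := s * (ln 4 + c2 + e * c3) + (1 - s) * c1.
  have h4 : C / e + c3 <= n%:R by near: n; exact: near_ge_natr.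
  have PsiC : C <= e * Psi n by rewrite mulrC -ler_pdivrMr//; have := hc3 n; lra.
  have h5 : (1 - s) * ((1 - e) * Psi n) <= (1 - s) * (c1 + T n).
    by rewrite ler_wpM2l ?hc1//; lra.
  have h6 : s * (ln 4 + 2 * ln n.+2%:R + mu n + \sum_(i < n) ln i.+2%:R) <=
      s * (ln 4 + e * (c3 + Psi n) + xi * Psi n + (c2 + (th + e) * Psi n)).
    rewrite ler_wpM2l//; have := hc2 n.
    have : e * n%:R <= e * (c3 + Psi n) by rewrite ler_pM2l.
    lra.
  have Psi0 : 0 <= Psi n.
    have : 0 <= xi * Psi n by apply: le_trans h1; near: n; exact: near_psi_ge.
    have : c3 <= n%:R by near: n; exact: near_ge_natr.
    by have := hc3 n; lra.
  have h7 : s * e * Psi n <= e * Psi n by rewrite -mulrA ler_piMl// mulr_ge0// ltW.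
  have h8 : (4 * e - (1 - s * (1 + th + xi))) * Psi n = 0.
    by rewrite e4 subrr mul0r.
  have h9 : 0 <= e * Psi n by rewrite mulr_ge0// ltW.
  move: h5 h6 h7 h8 h9 PsiC; rewrite /C.
  move: (\sum_(i < n) ln _) (ln 4) (ln n.+2%:R) (mu n) (T n) (Psi n) => *.
  by lra.
apply: (@hausdorff_measure_block_set R m s N0).
- exact: block_size_ge2.
- exact: block_size_nd.
- by rewrite s0.
move=> n nN; have m0 i : (0 : R) < (m i)%:R by rewrite ltr0n ltnW// block_size_ge2.
have -> : (ncyl m n.+1)%:R = expR (T n.+1) :> R.
  by rewrite /ncyl natr_prod expR_sum; apply: eq_bigr => i _; rewrite lnK ?posrE.
have -> : cyl_len m n.+1 * (m n.+1)%:R = expR (- (ln 4 + 2 * ln n.+3%:R + mu n.+1 +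
    \sum_(i < n.+1) ln i.+2%:R + T n.+1)).
  have D : (block_den m n.+1)%:R = expR (\sum_(i < n.+1) ln i.+2%:R + T n.+1) :> R.
    rewrite /block_den natr_prod -big_split expR_sum; apply: eq_bigr => i _.
    by rewrite expRD !lnK ?posrE// natrM.
  rewrite /cyl_len D expRN -!addrA !expRD expRM_natl !lnK ?posrE// natrM.
  field.
  by rewrite !gt_eqF ?expR_gt0//.
rewrite expR_powR -expRD -[X in X <= _]expR0 ler_expR.
by have := HN n.+1 (leqW nN); lra.
Unshelve. all: by end_near. Qed.

End LowerTheorem.

(** * The set of points with prescribed digit growth *)

Section PierceE.
Context {R : realType}.
Variable phi : nat -> R.
Hypothesis phi_gt0 : forall n : nat, (0 < n)%N -> 0 < phi n.
Hypothesis phi_nd : forall i j : nat, (0 < i)%N -> (i <= j)%N -> phi i <= phi j.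
Implicit Types (a b c e s t x g : R) (n i : nat).

Local Notation f n := (phi n.+1).
Local Notation S n := (\sum_(i < n) phi i.+1).

Let f_gt0 n : 0 < f n. Proof. exact: phi_gt0. Qed.
Let f_nd n : f n <= f n.+1. Proof. exact: phi_nd. Qed.

Lemma near_succ (P : nat -> Prop) : (\forall n \near \oo, P n) ->
  \forall n \near \oo, P n.+1.
Proof. by move=> [N _ H]; exists N => // n /= Nn; apply: H; exact: leqW. Qed.

Lemma pierce_E_dom x : pierce_E phi x -> pierce_dom x.
Proof. by move=> [x01 xi _]; rewrite in_itv in x01. Qed.

Lemma pierce_E_near x e : pierce_E phi x -> 0 < e ->
  \forall n \near \oo, (1 - e) * f n <= ln (dig n x)%:R <= (1 + e) * f n.
Proof.
move=> Ex e0; have xd := pierce_E_dom Ex; case: Ex => _ _ /cvgrPdist_le/(_ _ e0).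
move=> /near_succ; apply: filterS => n.
rewrite (pierce_digitE n xd) => h.
have f0 := f_gt0 n; move: h; rewrite ler_norml => /andP[h1 h2].
have E : ln (dig n x)%:R = ln (dig n x)%:R / f n * f n by rewrite divfK// gt_eqF.
by rewrite E !ler_pM2r//; apply/andP; split; lra.
Qed.

Lemma pierce_E_intro x : pierce_dom x ->
  (forall e, 0 < e -> \forall n \near \oo, `|ln (dig n x)%:R - f n| <= e * f n) ->
  pierce_E phi x.
Proof.
move=> xd H; case: (xd) => x01 xi; split=> //.
apply/cvgrPdist_le => e /H[N _ HN]; exists N.+1 => // -[//|n] /= Nn.
rewrite (pierce_digitE n xd); have := HN n Nn; have f0 := f_gt0 n => h.
rewrite -(ler_pM2r f0) -[X in _ * X <= _](gtr0_norm f0) -normrM mulrBl mul1r divfK ?gt_eqF//.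
by rewrite distrC.
Qed.

Lemma pierce_E_null (al be : nat -> R) s : 0 < s ->
  (forall x, pierce_E phi x -> \forall n \near \oo,
     al n <= ln (dig n x)%:R <= be n) ->
  (forall N, hausdorff_measure s (growth_set al be N) = 0%E) ->
  hausdorff_measure s (pierce_E phi) = 0%E.
Proof.
move=> s0 H G; apply: (hausdorff_measure_eq0_sub (B := \bigcup_N growth_set al be N)).
  by move=> x Ex; have [N _ HN] := H x Ex; exists N => //; split => //; exact: pierce_E_dom.
exact: hausdorff_measure_eq0_bigcup.
Qed.

Lemma pierce_E_null_fast s t : 0 < s -> 1 < s * (1 + t) ->
  (forall K, exists2 n, (K <= n)%N & t * S n <= f n) ->
  hausdorff_measure s (pierce_E phi) = 0%E.
Proof.
move=> s0 st Ht; pose A := s * (1 + t).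
(* Half of the value of [e] for which [1 + e = A * (1 - e)]. *)
pose e := (A - 1) / (2 * (A + 1)).
have A1 : 1 < A by [].
have eE : e * (2 * (A + 1)) = A - 1 by rewrite /e divfK// gt_eqF//; lra.
have e0 : 0 < e by rewrite divr_gt0//; lra.
have e1 : e < 1 by rewrite ltr_pdivrMr; lra.
apply: (pierce_E_null s0 (fun x Ex => pierce_E_near Ex e0)) => N.
apply: (@growth_set_null_fast _ _ _ _ t) => //; first by rewrite e0.
have -> : s * (1 - e) * (1 + t) = A * (1 - e) by rewrite /A; ring.
have : 0 < e * A by rewrite mulr_gt0//; lra.
by lra.
Qed.

Lemma pierce_E_null_poly s g : 0 < s -> 0 < g -> g - 1 < s * g ->
  (forall e, 0 < e -> \forall n \near \oo,
     `|f n - g * ln n.+1%:R| <= e * ln n.+1%:R) ->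
  hausdorff_measure s (pierce_E phi) = 0%E.
Proof.
move=> s0 g0 gs H.
(* With [a = g - d] and [b = g + d], the second bound gives [b - 1 < s * a]. *)
pose d := Num.min (g / 2) ((s * g - g + 1) / (2 * (1 + s))).
have d0 : 0 < d.
  by rewrite lt_min; apply/andP; split; rewrite divr_gt0//; lra.
have dg : d <= g / 2 by rewrite ge_min lexx.
have ds : d * (1 + s) < s * g - g + 1.
  have : d <= (s * g - g + 1) / (2 * (1 + s)) by rewrite ge_min lexx orbT.
  rewrite ler_pdivlMr; last lra.
  by lra.
(* [e] is such that [(1 + e) * (g + e) <= g + d] and [g - d <= (1 - e) * (g - e)]. *)
pose e := Num.min 1 (d / (2 + g)).
have e0 : 0 < e by rewrite lt_min ltr01 divr_gt0//; lra.
have e1 : e <= 1 by rewrite ge_min lexx.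
have ed : e * (2 + g) <= d.
  by rewrite -ler_pdivlMr; [rewrite ge_min lexx orbT|lra].
clearbody d e.
apply: (@pierce_E_null (fun i => (g - d) * ln i.+1%:R) (fun i => (g + d) * ln i.+1%:R)) => //.
  move=> x Ex; near=> n.
  have /andP[h1 h2] : (1 - e) * f n <= ln (dig n x)%:R <= (1 + e) * f n.
    by near: n; exact: pierce_E_near.
  have /ler_normlP[h3 h4] : `|f n - g * ln n.+1%:R| <= e * ln n.+1%:R.
    by near: n; exact: H.
  have L0 : (0 : R) <= ln n.+1%:R by rewrite ln_ge0// ler1n.
  have l1 : (1 - e) * ((g - e) * ln n.+1%:R) <= (1 - e) * f n.
    by rewrite ler_wpM2l//; lra.
  have l2 : (1 + e) * f n <= (1 + e) * ((g + e) * ln n.+1%:R).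
    by rewrite ler_wpM2l//; lra.
  have ee : e * e <= e by rewrite ler_piMl// ltW.
  have k1 : (g - d) * ln n.+1%:R <= (1 - e) * (g - e) * ln n.+1%:R.
    by rewrite ler_wpM2r//; have := mulr_ge0 (ltW e0) (ltW e0); lra.
  have k2 : (1 + e) * (g + e) * ln n.+1%:R <= (g + d) * ln n.+1%:R.
    by rewrite ler_wpM2r//; lra.
  by apply/andP; split; lra.
move=> N; apply: growth_set_null_poly => //; lra.
Unshelve. all: by end_near. Qed.

(** The last hypothesis puts the block set into [pierce_E phi]; the term [ln 2] is
    the error made by [block_set_ln_dig]. *)
Lemma pierce_E_measure_neq0 psi th xi s : (forall i, psi i <= psi i.+1) ->
  0 <= th -> (\forall n \near \oo, ln n.+1%:R <= th * psi n) ->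
  0 <= xi -> (\forall n \near \oo, psi n <= xi * \sum_(i < n) psi i) ->
  0 <= s -> s * (1 + th + xi) < 1 ->
  (forall e, 0 < e -> \forall n \near \oo,
     ln 2 + `|ln n.+1%:R + psi n - f n| <= e * f n) ->
  hausdorff_measure s (pierce_E phi) <> 0%E.
Proof.
move=> psind th0 psith xi0 psixi s0 sth H E0.
apply: (hausdorff_measure_block_size psind th0 psith xi0 psixi s0 sth).
apply: hausdorff_measure_eq0_sub E0 => x bx; apply: pierce_E_intro; first by case: bx.
move=> e e0; near=> n.
have h1 : ln 2 + `|ln n.+1%:R + psi n - f n| <= e * f n by near: n; exact: H.
apply: le_trans h1.
have h2 : forall x, block_set (block_size psi) x ->
  `|ln (dig n x)%:R - (ln n.+1%:R + psi n)| <= ln 2.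
  by near: n; exact: (block_set_ln_dig th0 psith).
have -> : ln (dig n x)%:R - f n =
  ln (dig n x)%:R - (ln n.+1%:R + psi n) + (ln n.+1%:R + psi n - f n) by ring.
by apply: le_trans (ler_normD _ _) _; rewrite lerD2r h2.
Unshelve. all: by end_near. Qed.

(** Blocks built from [psi = phi], for which [th] can be taken arbitrarily small. *)
Lemma pierce_E_measure_neq0_fast s t : (forall c, \forall n \near \oo, c * ln n.+1%:R <= f n) ->
  0 <= t -> (\forall n \near \oo, f n <= t * S n) -> 0 <= s -> s * (1 + t) < 1 ->
  hausdorff_measure s (pierce_E phi) <> 0%E.
Proof.
move=> H t0 ft s0 st.
have Hth e : 0 < e -> \forall n \near \oo, ln n.+1%:R <= e * f n.
  move=> e0; near=> n; have : e^-1 * ln n.+1%:R <= f n by near: n; exact: H.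
  by rewrite -ler_pdivrMl ?invr_gt0// invrK.
pose th := (1 - s * (1 + t)) / (2 * (1 + s)).
have thE : th * (2 * (1 + s)) = 1 - s * (1 + t) by rewrite /th divfK// gt_eqF//; lra.
have th0 : 0 < th by rewrite divr_gt0//; lra.
apply: (@pierce_E_measure_neq0 (fun n => f n) th t) => //.
- exact: ltW.
- exact: Hth.
- by clearbody th; lra.
move=> e e0; near=> n.
have h1 : ln n.+1%:R <= (e / 2) * f n.
  by near: n; apply: Hth; rewrite divr_gt0.
have h2 : ln 2 <= (e / 2) * f n.
  apply: le_trans h1; rewrite ler_ln ?posrE// ler_nat.
  by near: n; exists 1%N.
rewrite addrK ger0_norm; first by lra.
by rewrite ln_ge0// ler1n.
Unshelve. all: by end_near. Qed.

(** Blocks built from [psi n = (g - 1) * ln (n + 1)], for which [th = 1 / (g - 1)]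
    and [xi] can be taken arbitrarily small. *)
Lemma pierce_E_measure_neq0_poly s g : 1 < g ->
  (forall e, 0 < e -> \forall n \near \oo,
     `|f n - g * ln n.+1%:R| <= e * ln n.+1%:R) ->
  0 <= s -> s * g < g - 1 ->
  hausdorff_measure s (pierce_E phi) <> 0%E.
Proof.
move=> g1 H s0 sg; have g10 : 0 < g - 1 by lra.
pose th := (g - 1)^-1; have th0 : 0 < th by rewrite invr_gt0.
have thE : th * (g - 1) = 1 by rewrite mulVf// gt_eqF.
have st : s * (1 + th) < 1.
  have -> : s * (1 + th) = s * g / (g - 1) by rewrite /th; field; rewrite gt_eqF.
  by rewrite ltr_pdivrMr// mul1r.
pose xi := (1 - s * (1 + th)) / (2 * (1 + s)).
have xiE : xi * (2 * (1 + s)) = 1 - s * (1 + th) by rewrite /xi divfK// gt_eqF//; lra.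
have xi0 : 0 < xi by rewrite divr_gt0//; lra.
clearbody xi th.
apply: (@pierce_E_measure_neq0 (fun n => (g - 1) * ln n.+1%:R) th xi) => //.
- by move=> i; rewrite ler_pM2l// ler_ln ?posrE// ler_nat.
- exact: ltW.
- by near=> n; rewrite mulrA thE mul1r.
- exact: ltW.
- near=> n; rewrite -mulr_sumr -/(lnfact _) mulrCA ler_pM2l//.
  have h1 : ln n.+2%:R <= xi * n%:R by near: n; exact: ln_natS_le.
  have h2 : (expR 2 : R) <= n%:R by near: n; exact: near_ge_natr.
  have n0 : (0 : R) < n%:R by apply: lt_le_trans h2; exact: expR_gt0.
  have h3 : (2 : R) <= ln n%:R by rewrite -[X in X <= _]expRK ler_ln ?posrE ?expR_gt0.
  have h4 : n%:R * 2 <= n%:R * ln n%:R :> R by rewrite ler_pM2l.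
  have h5 : xi * n%:R <= xi * lnfact n by rewrite ler_pM2l//; have := @lnfact_ge R n; lra.
  have h6 : ln n.+1%:R <= ln n.+2%:R :> R by rewrite ler_ln ?posrE// ler_nat.
  by lra.
- by lra.
move=> e e0.
(* [d] solves [2 * d = e * (g - d)]: one [d] absorbs [ln 2], the other one the
   distance from [f n] to [g * ln n.+1]. *)
pose d := e * g / (2 + e).
have dE : d * (2 + e) = e * g by rewrite /d divfK// gt_eqF//; lra.
have d0 : 0 < d by rewrite divr_gt0 ?mulr_gt0//; lra.
clearbody d; near=> n.
have h1 : `|f n - g * ln n.+1%:R| <= d * ln n.+1%:R by near: n; exact: H.
have h2 : ln 2 / d <= ln n.+1%:R by near: n; exact: near_ln_ge.
have -> : ln n.+1%:R + (g - 1) * ln n.+1%:R - f n = - (f n - g * ln n.+1%:R) by ring.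
rewrite normrN; rewrite ler_pdivrMr// in h2.
move/ler_normlP: (h1) => [h3 h4].
have L0 : (0 : R) <= ln n.+1%:R by rewrite ln_ge0// ler1n.
have h5 : e * ((g - d) * ln n.+1%:R) <= e * f n by rewrite ler_pM2l//; lra.
have h6 : d * (2 + e) * ln n.+1%:R = e * g * ln n.+1%:R by rewrite dE.
have h7 : 0 <= d * ln n.+1%:R by rewrite mulr_ge0// ltW.
by lra.
Unshelve. all: by end_near. Qed.

(** The [n]-th digit is at least [n], so its logarithm cannot be asymptotic to
    something that stays below [c * ln n]. *)
Lemma pierce_E_empty c : c < 1 -> (\forall n \near \oo, f n <= c * ln n.+1%:R) ->
  pierce_E phi = set0.
Proof.
move=> c1 H; rewrite -subset0 => x Ex; have xd := pierce_E_dom Ex.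
pose e := (1 - c) / 2; have e0 : 0 < e by rewrite divr_gt0//; lra.
suff : \forall n \near \oo, False by case=> N _ /(_ N (leqnn _)).
near=> n.
have h1 : f n <= c * ln n.+1%:R by near: n; exact: H.
have /andP[_ h2] : (1 - e) * f n <= ln (dig n x)%:R <= (1 + e) * f n.
  by near: n; exact: pierce_E_near.
have h3 : ln n.+1%:R <= ln (dig n x)%:R :> R.
  by rewrite ler_ln ?posrE ?ltr0n ?dig_gt0// ler_nat dig_gtn.
have h4 : 1 <= ln n.+1%:R :> R by near: n; exact: near_ln_ge.
have h5 : (1 + e) * f n <= (1 + e) * (c * ln n.+1%:R) by rewrite ler_pM2l//; lra.
have h6 : (1 + e) * c < 1 by rewrite /e; nra.
have h7 : (1 + e) * c * ln n.+1%:R < ln n.+1%:R by rewrite gtr_pMl//; lra.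
lra.
Unshelve. all: by end_near. Qed.

End PierceE.

(** * Limit superior and the dimension formula *)

Section Limsup.
Context {R : realType}.
Implicit Types (u : nat -> R) (t : R).

Lemma limn_esup_lt_near u t : (limn_esup (fun n => (u n)%:E) < t%:E)%E ->
  \forall n \near \oo, u n <= t.
Proof.
move=> /ereal_inf_lt[_ [V Voo <-] Vt]; apply: filterS Voo => n Vn.
rewrite -lee_fin; apply: le_trans (ltW Vt).
by apply: ereal_sup_ubound; exists n.
Qed.

Lemma limn_esup_gt_frequently u t : (t%:E < limn_esup (fun n => (u n)%:E))%E ->
  forall K, exists2 n, (K <= n)%N & t < u n.
Proof.
move=> ut K.
have : (t%:E < ereal_sup [set (u n)%:E | n in [set n | (K <= n)%N]])%E.
  apply: lt_le_trans ut _; apply: ereal_inf_lbound.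
  by exists [set n | (K <= n)%N] => //; exists K.
by move=> /ereal_sup_gt[_ [n /= Kn <-]]; rewrite lte_fin; exists n.
Qed.

Lemma limn_esup_eq0 u : (forall n, 0 <= u n) ->
  (forall e, 0 < e -> \forall n \near \oo, u n <= e) ->
  limn_esup (fun n => (u n)%:E) = 0%E.
Proof.
move=> u0 H; apply/eqP; rewrite eq_le; apply/andP; split; last first.
  apply: limf_esup_ge0; last by move=> n; rewrite lee_fin.
  by move=> [N _ /(_ N (leqnn _))].
apply/lee_addgt0Pr => e e0; rewrite add0e.
apply: (@le_trans _ _ (ereal_sup [set (u n)%:E | n in [set n | u n <= e]])).
  apply: ereal_inf_lbound; exists [set n | u n <= e] => //; exact: H.
by apply: ge_ereal_sup => _ [n /= ne <-]; rewrite lee_fin.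
Qed.

End Limsup.

Section Dimension.
Context {R : realType}.
Variable phi : nat -> R.
Hypothesis phi_gt0 : forall n : nat, (0 < n)%N -> 0 < phi n.
Hypothesis phi_nd : forall i j : nat, (0 < i)%N -> (i <= j)%N -> phi i <= phi j.
Implicit Types (c e s t g : R) (n i : nat).

Local Notation S n := (\sum_(i < n) phi i.+1).
Let u n := phi n.+1 / \sum_(1 <= k < n.+1) phi k.
Local Notation xi := (limn_esup (fun n => (u n)%:E)).

Let sumE n : \sum_(1 <= k < n.+1) phi k = S n.
Proof. by rewrite big_add1 big_mkord. Qed.

Let S_gt0 n : 0 < S n.+1.
Proof.
rewrite big_ord_recr /= ltr_wpDl// ?sumr_ge0 ?phi_gt0// => i _.
by rewrite ltW// phi_gt0.
Qed.

Let u_ge0 n : 0 <= u n.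
Proof.
by rewrite divr_ge0 ?(ltW (phi_gt0 _))// sumE sumr_ge0// => i _; rewrite ltW// phi_gt0.
Qed.

Let u_le t n : (0 < n)%N -> (u n <= t) = (phi n.+1 <= t * S n).
Proof. by case: n => // n _; rewrite /u sumE ler_pdivrMr. Qed.

Let xi_ge0 : (0 <= xi)%E.
Proof.
apply: limf_esup_ge0; last by move=> n; rewrite lee_fin.
by move=> [N _ /(_ N (leqnn _))].
Qed.

Lemma xi_lt_near t : (xi < t%:E)%E -> \forall n \near \oo, phi n.+1 <= t * S n.
Proof.
move=> /limn_esup_lt_near H; near=> n.
by rewrite -u_le; [near: n|near: n; exists 1%N].
Unshelve. all: by end_near. Qed.

Lemma xi_gt_frequently t : (t%:E < xi)%E ->
  forall K, exists2 n, (K <= n)%N & t * S n <= phi n.+1.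
Proof.
move=> /limn_esup_gt_frequently H K; have [n Kn tn] := H K.+1.
exists n; first exact: ltnW.
by rewrite leNgt; apply/negP => /ltW; rewrite -u_le ?(leq_trans _ Kn)// leNgt tn.
Qed.

(** The numerator is [O(ln n)] while the denominator is at least [n * phi 1]. *)
Lemma xi_eq0 c : (\forall n \near \oo, phi n.+1 <= c * ln n.+1%:R) -> xi = 0%E.
Proof.
have p1 : 0 < phi 1 by exact: phi_gt0.
have c1 : 0 < `|c| + 1 by rewrite ltr_wpDl.
move=> H; apply: limn_esup_eq0 => // e e0; near=> n.
rewrite u_le; last by near: n; exists 1%N.
have h1 : phi n.+1 <= c * ln n.+1%:R by near: n; exact: H.
pose d := e * phi 1 / (`|c| + 1).
have dE : d * (`|c| + 1) = e * phi 1 by rewrite /d divfK// gt_eqF.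
have h2 : ln n.+2%:R <= d * n%:R.
  by near: n; apply: ln_natS_le; apply: divr_gt0 => //; apply: mulr_gt0.
have L0 : (0 : R) <= ln n.+1%:R by rewrite ln_ge0// ler1n.
have h3 : ln n.+1%:R <= ln n.+2%:R :> R by rewrite ler_ln ?posrE// ler_nat.
have h4 : n%:R * phi 1 <= S n.
  by apply: (sum_nd_ge (f := fun i => phi i.+1)) => i; exact: phi_nd.
have h5 : c * ln n.+1%:R <= (`|c| + 1) * ln n.+1%:R.
  by rewrite ler_wpM2r// (le_trans (ler_norm c))// lerDl.
have h6 : (`|c| + 1) * ln n.+1%:R <= (`|c| + 1) * (d * n%:R).
  by rewrite ler_pM2l//; exact: le_trans h2.
have h7 : (`|c| + 1) * (d * n%:R) = e * (n%:R * phi 1).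
  by rewrite mulrA [_ * d]mulrC dE; ring.
have h8 : e * (n%:R * phi 1) <= e * S n by rewrite ler_pM2l.
by rewrite (le_trans h1)// (le_trans h5)// (le_trans h6)// h7.
Unshelve. all: by end_near. Qed.

Lemma dim_fast : (forall c, \forall n \near \oo, c * ln n.+1%:R <= phi n.+1) ->
  hausdorff_dim (pierce_E phi) = ((1 + xi)^-1)%E.
Proof.
move=> H; apply/eqP; rewrite eq_le; apply/andP; split.
  apply: hausdorff_dim_le; first by rewrite inve_ge0 adde_ge0.
  move=> s; have := xi_ge0; have := @xi_gt_frequently.
  case: xi => [x|F _|//]; last first.
    rewrite addey// invey lte_fin => s0.
    apply: (@pierce_E_null_fast _ _ phi_gt0 phi_nd s s^-1) => //.
      by rewrite mulrDr mulr1 mulfV ?gt_eqF//; lra.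
    by apply: F; exact: ltry.
  move=> F; rewrite lee_fin => x0; rewrite -EFinD inver gt_eqF; last lra.
  rewrite lte_fin => sx.
  have s0 : 0 < s by apply: lt_trans sx; rewrite invr_gt0; lra.
  have sx1 : 1 < s * (1 + x) by rewrite -ltr_pdivrMr ?div1r//; lra.
  pose d := (s * (1 + x) - 1) / (2 * s).
  have dE : d * (2 * s) = s * (1 + x) - 1 by rewrite /d divfK// gt_eqF//; lra.
  have d0 : 0 < d by rewrite divr_gt0//; lra.
  apply: (@pierce_E_null_fast _ _ phi_gt0 phi_nd s (x - d)) => //.
    by clearbody d; lra.
  by apply: F; rewrite lte_fin; lra.
apply: hausdorff_dim_ge => s s0.
have := xi_ge0; have := @xi_lt_near; case: xi => [x F|_ _|//]; last first.
  by rewrite addey// invey lte_fin ltNge s0.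
rewrite lee_fin => x0; rewrite -EFinD inver gt_eqF; last lra.
rewrite lte_fin => sx.
have sx1 : s * (1 + x) < 1 by rewrite -ltr_pdivlMr ?div1r//; lra.
pose d := (1 - s * (1 + x)) / (2 * (1 + s)).
have dE : d * (2 * (1 + s)) = 1 - s * (1 + x) by rewrite /d divfK// gt_eqF//; lra.
have d0 : 0 < d by rewrite divr_gt0//; lra.
apply: (@pierce_E_measure_neq0_fast _ _ phi_gt0 phi_nd s (x + d)) => //.
- by lra.
- by apply: F; rewrite lte_fin; lra.
- by clearbody d; lra.
Qed.

Lemma dim_poly g : 1 <= g ->
  (forall e, 0 < e -> \forall n \near \oo,
     `|phi n.+1 - g * ln n.+1%:R| <= e * ln n.+1%:R) ->
  hausdorff_dim (pierce_E phi) = (1 - g^-1)%:E.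
Proof.
move=> g1 H; have g0 : 0 < g by lra.
have gi : g^-1 * g = 1 by rewrite mulVf// gt_eqF.
have gi1 : g^-1 <= 1 by rewrite invf_le1.
apply/eqP; rewrite eq_le; apply/andP; split.
  apply: hausdorff_dim_le; first by rewrite lee_fin subr_ge0.
  move=> s; rewrite lte_fin => gs.
  apply: (@pierce_E_null_poly _ _ phi_gt0 s g) => //.
    by apply: le_lt_trans gs; rewrite subr_ge0.
  by move: gs; rewrite -(ltr_pM2r g0) mulrBl gi mul1r.
apply: hausdorff_dim_ge => s s0; rewrite lte_fin -(ltr_pM2r g0) mulrBl gi mul1r => sg.
apply: (@pierce_E_measure_neq0_poly _ _ phi_gt0 s g) => //.
have : 0 <= s * g by rewrite mulr_ge0// ltW.
lra.
Qed.

End Dimension.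

Section PhiGamma.
Context {R : realType}.
Variables (phi : nat -> R).

Lemma phi_gamma_infty : (phi n / ln n%:R)%:E @[n --> \oo] --> +oo%E ->
  forall c, \forall n \near \oo, c * ln n.+1%:R <= phi n.+1.
Proof.
move=> /cvgeyPge H c; near=> n.
have L0 : (0 : R) < ln n.+1%:R.
  by apply: lt_le_trans ltr01 _; near: n; exact: near_ln_ge.
rewrite -ler_pdivlMr// -lee_fin.
by near: n; apply: (@near_succ (fun n => (c%:E <= (phi n / ln n%:R)%:E)%E)); exact: H.
Unshelve. all: by end_near. Qed.

Lemma phi_gamma_fin (g : R) : (phi n / ln n%:R)%:E @[n --> \oo] --> g%:E ->
  forall e, 0 < e -> \forall n \near \oo,
     `|phi n.+1 - g * ln n.+1%:R| <= e * ln n.+1%:R.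
Proof.
move=> /fine_cvgP[_ /cvgrPdist_le H] e e0; near=> n.
have L0 : (0 : R) < ln n.+1%:R.
  by apply: lt_le_trans ltr01 _; near: n; exact: near_ln_ge.
have h : `|g - phi n.+1 / ln n.+1%:R| <= e.
  by near: n; apply: (@near_succ (fun n => `|g - phi n / ln n%:R| <= e)); exact: H.
rewrite distrC.
have -> : g * ln n.+1%:R - phi n.+1 = (g - phi n.+1 / ln n.+1%:R) * ln n.+1%:R.
  by rewrite mulrBl divfK// gt_eqF.
by rewrite normrM (gtr0_norm L0) ler_pM2r.
Unshelve. all: by end_near. Qed.

End PhiGamma.

Theorem theorem1p1 (R : realType) (phi : nat -> R) (gamma : \bar R)
  (phi_gt0 : forall n : nat, (0 < n)%N -> 0 < phi n)
  (phi_nd : forall m n : nat, (0 < m)%N -> (m <= n)%N -> phi m <= phi n)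
  (gamma_ge0 : (0 <= gamma)%E)
  (phi_gamma : (phi n / ln n%:R)%:E @[n --> \oo] --> gamma) :
  let xi : \bar R :=
    limn_esup (fun n : nat => (phi n.+1 / \sum_(1 <= k < n.+1) phi k)%:E) in
  [/\ hausdorff_dim (pierce_E phi) = maxe 0%E ((1 - gamma^-1) / (1 + xi))%E,
      gamma = +oo%E -> hausdorff_dim (pierce_E phi) = ((1 + xi)^-1)%E,
      (1 <= gamma < +oo)%E ->
        hausdorff_dim (pierce_E phi) = (1 - gamma^-1)%E
    & (gamma < 1)%E ->
        pierce_E phi = set0 /\ hausdorff_dim (pierce_E phi) = 0%E].
Proof.
move=> xi; have xi0 : (0 <= (1 + xi)^-1)%E.
  rewrite inve_ge0 adde_ge0//; apply: limf_esup_ge0.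
    by move=> [N _ /(_ N (leqnn _))].
  move=> n; rewrite lee_fin divr_ge0 ?(ltW (phi_gt0 _ _))//.
  by rewrite big_nat sumr_ge0// => i /andP[i0 _]; rewrite ltW// phi_gt0.
case: gamma gamma_ge0 phi_gamma => [g|_|//]; last first.
  move=> /phi_gamma_infty H; have D := dim_fast phi_gt0 phi_nd H.
  split=> //.
    by rewrite D invey sube0 mul1e; apply/esym/max_idPr.
  by rewrite ltxx andbF.
rewrite lee_fin => g0 /phi_gamma_fin H.
have [g1|g1] := leP 1 g.
  have D := dim_poly phi_gt0 g1 H.
  have gE : (1 - (g%:E)^-1 = (1 - g^-1)%:E :> \bar R)%E.
    by rewrite inver gt_eqF// (lt_le_trans ltr01).
  have gi : 0 <= 1 - g^-1 by rewrite subr_ge0 invf_le1// (lt_le_trans ltr01).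
  split=> //; last by rewrite lte_fin ltNge g1.
  + have -> : xi = 0%E.
      apply: (xi_eq0 phi_gt0 phi_nd (c := g + 1)); near=> n.
      have /ler_normlP[_ h] : `|phi n.+1 - g * ln n.+1%:R| <= 1 * ln n.+1%:R.
        by near: n; exact: H.
      lra.
    rewrite adde0 inve1 mule1 gE D.
    by apply/esym/max_idPr; rewrite lee_fin.
  + by rewrite gE.
have E0 : pierce_E phi = set0.
  apply: (pierce_E_empty phi_gt0 (c := (g + 1) / 2)); first lra.
  pose e := (1 - g) / 2; have e0 : 0 < e by rewrite /e; lra.
  near=> n; have /ler_normlP[_ h] : `|phi n.+1 - g * ln n.+1%:R| <= e * ln n.+1%:R.
    by near: n; exact: H.
  by rewrite /e in h; lra.
split=> //.
- rewrite E0 hausdorff_dim_set0; apply/esym/max_idPl.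
  rewrite mule_le0_ge0// sube_le0.
  move: g0; rewrite le_eqVlt => /orP[/eqP <-|g0]; first by rewrite inve0 leey.
  by rewrite inver gt_eqF// lee_fin invf_ge1// ltW.
- by rewrite lee_fin leNgt g1.
- by move=> _; rewrite E0 hausdorff_dim_set0.
Unshelve. all: by end_near. Qed.
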